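(* Let $X$ be an infinite-dimensional uniformly convex real Banach space whose norm is of class $C^1$ on $X\setminus\{0\}$, let $\Phi\in C^1(X\setminus\{0\})$, and assume that $\Phi$ satisfies (H1). Then: (1) If $\lambda_1$ is achieved (i.e. the infimum $\lambda_1=\inf_{u\in\mathcal S}\Phi(t(u)u)=\inf_{u\in\mathcal N}\Phi(u)$ is attained), then it is the ground state level of $\Phi$, i.e. the least critical level of $\Phi$. (2) If (H2) holds, then $(\lambda_n)_{n\ge1}$ is a nondecreasing sequence of critical values of $\Phi$. In particular, $\Phi$ has infinitely many pairs of critical points. (3) If (H2) and (H3) hold, then $\lambda_n\to\infty$ as $n\to\infty$, so that $\Phi$ has infinitely many critical values.
   Context: $\mathcal S$ is the unit sphere of $X$, and $\mathcal N=\{u\in X\setminus\{0\}:\Phi'(u)u=0\}$ is the Nehari set of $\Phi$. Critical points of $\Phi$ are points $u\in X\setminus\{0\}$ with $\Phi'(u)=0$; critical values (levels) are the values of $\Phi$ at critical points. (H1): for every $u\in X\setminus\{0\}$ the map $t\mapsto\Phi(tu)$, defined for $t>0$, has exactly one critical point $t(u)>0$, which is either a global maximum point or a global minimum point. Moreover, the map $u\mapsto t(u)$ is bounded away from zero on $\mathcal S$ and bounded from above on every compact subset of $\mathcal S$. (H2): $\Phi$ is even, bounded from below on $\mathcal N$, and satisfies the Palais-Smale condition on $\mathcal N$, i.e. any sequence $(u_n)\subset\mathcal N$ such that $(\Phi(u_n))$ is bounded and $\Phi'(u_n)\to0$ in $X^*$ has a subsequence converging in $X\setminus\{0\}$. (H3):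 $\Phi(t(u_n)u_n)\to\infty$ for any sequence $(u_n)\subset\mathcal S$ such that $u_n\rightharpoonup0$ weakly in $X$. For $n\in\mathbb N$, $\lambda_n:=\inf_{F\in\mathcal F_n}\sup_{u\in F}\Phi(t(u)u)$, where $\mathcal F_n$ is the family of compact, symmetric ($F=-F$) subsets $F\subset\mathcal S$ with $\gamma(F)\ge n$, $\gamma$ being the Krasnoselskii genus (the least $k$ such that there is an odd continuous map $F\to\mathbb R^k\setminus\{0\}$, and $\infty$ if there is none). In particular $\lambda_1=\inf_{u\in\mathcal S}\Phi(t(u)u)=\inf_{u\in\mathcal N}\Phi(u)$. *)

(* Defs.v *)
From mathcomp Require Import all_boot all_order all_algebra.
From mathcomp Require Import all_classical all_reals all_analysis.

Set Implicit Arguments.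
Unset Strict Implicit.
Unset Printing Implicit Defensive.
Import Order.TTheory GRing.Theory Num.Theory.
Import numFieldNormedType.Exports.

Local Open Scope classical_set_scope.
Local Open Scope ring_scope.

Section BanachSpace.
Context {R : realType} {X : normedModType R}.

Definition infinite_dimensional : Prop :=
  forall n : nat, exists e : 'I_n -> X,
    forall a : 'I_n -> R, \sum_(i < n) a i *: e i = 0 -> forall i, a i = 0.

Definition uniformly_convex : Prop :=
  forall eps : R, 0 < eps -> exists2 delta : R, 0 < delta &
    forall x y : X, `|x| = 1 -> `|y| = 1 -> eps <= `|x - y| ->
      `|2^-1 *: (x + y)| <= 1 - delta.

(* The norm of X^*; it is +oo on unbounded functionals. *)
Definition dual_norm (f : X -> R) : \bar R :=
  ereal_sup [set `|f v|%:E | v in [set v : X | `|v| <= 1]].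

(* Functions on X \ {0} are represented by total functions on X whose value
   at 0 is never used. *)
Definition C1_off0 (f : X -> R) : Prop :=
  forall u : X, u != 0 ->
    differentiable f u /\
    dual_norm ('d f v \- 'd f u) @[v --> u] --> 0%E.

Definition weakly_cvg (u : nat -> X) (l : X) : Prop :=
  forall f : {linear X -> R}, continuous f -> f (u n) @[n --> \oo] --> f l.

Definition sphere : set X := [set u | `|u| = 1].

Definition symmetric_set (F : set X) : Prop := [set - u | u in F] = F.

Definition odd_map_to_punctured (F : set X) (k : nat) : Prop :=
  exists f : X -> 'rV[R]_k,
    [/\ {within F, continuous f},
        forall u, F u -> f (- u) = - f u &
        forall u, F u -> f u != 0].

(* The infimum of a set of natural numbers is its least element, and +oo if
   the set is empty. *)
Definition genus (F : set X) : \bar R :=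
  ereal_inf [set (k%:R)%:E | k in odd_map_to_punctured F].

Definition genus_family (n : nat) : set (set X) :=
  [set F | [/\ compact F, symmetric_set F, F `<=` sphere &
               ((n%:R)%:E <= genus F)%E]].

End BanachSpace.

Arguments infinite_dimensional {R} X.
Arguments uniformly_convex {R} X.
Arguments sphere {R} X.
Arguments genus_family {R} X n.

Section Functional.
Context {R : realType} {X : normedModType R}.
Variable Phi : X -> R.

Definition critical_points : set X :=
  [set u | u != 0 /\ forall v, 'd Phi u v = 0].

Definition critical_values : set R := Phi @` critical_points.

(* The sets {u, -u} of critical points. *)
Definition critical_pairs : set (set X) :=
  [set P | exists u, [/\ critical_points u, critical_points (- u) &
                         P = [set u; - u]]].

Definition ground_state_level (c : R) : Prop :=
  critical_values c /\ forall d, critical_values d -> c <= d.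

Definition nehari : set X := [set u | u != 0 /\ 'd Phi u u = 0].

Definition ray_critical (u : X) : set R :=
  [set s : R | 0 < s /\ is_derive s (1 : R) (fun r : R => Phi (r *: u)) 0].

(* The number t(u); (H1) makes it the only element of [ray_critical u]. *)
Definition ray_time (u : X) : R := get (ray_critical u).

Definition ray_value (u : X) : R := Phi (ray_time u *: u).

Definition H1 : Prop :=
  [/\ forall u : X, u != 0 ->
        (exists! s : R, ray_critical u s) /\
        ((forall s : R, 0 < s -> Phi (s *: u) <= ray_value u) \/
         (forall s : R, 0 < s -> ray_value u <= Phi (s *: u))),
      exists2 delta : R, 0 < delta &
        forall u, sphere X u -> delta <= ray_time u &
      forall K : set X, compact K -> K `<=` sphere X ->
        exists M : R, forall u, K u -> ray_time u <= M].

Definition even_off0 : Prop := forall u : X, u != 0 -> Phi (- u) = Phi u.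

Definition palais_smale_nehari : Prop :=
  forall u : nat -> X,
    (forall n, nehari (u n)) ->
    (exists M : R, forall n, `|Phi (u n)| <= M) ->
    dual_norm ('d Phi (u n)) @[n --> \oo] --> 0%E ->
    exists (phi : nat -> nat) (l : X),
      [/\ {homo phi : m n / (m < n)%N}, l != 0 &
          u (phi n) @[n --> \oo] --> l].

Definition H2 : Prop :=
  [/\ even_off0,
      exists m : R, forall u, nehari u -> m <= Phi u &
      palais_smale_nehari].

Definition H3 : Prop :=
  forall u : nat -> X, (forall n, sphere X (u n)) -> weakly_cvg u 0 ->
    ray_value (u n) @[n --> \oo] --> +oo.

Definition lambda (n : nat) : \bar R :=
  ereal_inf [set ereal_sup [set (ray_value u)%:E | u in F]
            | F in genus_family X n].

Definition sphere_inf : \bar R :=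
  ereal_inf [set (ray_value u)%:E | u in sphere X].

Definition nehari_inf : \bar R := ereal_inf [set (Phi u)%:E | u in nehari].

End Functional.

(* Main.v *)
Require Import Defs.
From mathcomp Require Import all_boot all_order all_algebra.
From mathcomp Require Import all_classical all_reals all_analysis.
From mathcomp Require Import lra ring zify.
From mathcomp Require Import finmap.
Import Order.TTheory GRing.Theory Num.Theory.
Import numFieldNormedType.Exports.
Local Open Scope classical_set_scope.
Local Open Scope ring_scope.
Set Implicit Arguments.
Unset Strict Implicit.
Unset Printing Implicit Defensive.

(** The number t(u) depends continuously on u, so Psi (u) = Phi (t(u) u) is a
continuous function on the complement of the origin, invariant under positive
scaling, whose critical points are the directions of the critical points of Phi;
its derivative at u is v |-> t(u) Phi'(t(u) u) v ([reduced_diff]). It is obtained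
without differentiating t: since t(u) is an extremum on each ray, Psi (u + s v) and
Psi (u) can be compared at one common time ([descent_near]). A minimum of Psi on the sphere is
thus a critical level, and it is the least one because every critical point lies
on the Nehari set.

The levels lambda_n are finite: Phi is bounded below on the Nehari set, and in infinite dimension there are compact
symmetric sets of every genus ([genus_family_exists]), by the Borsuk-Ulam theorem
([borsuk_ulam]). The latter is proved by a mod 2 count of alternating simplices in
subdivisions of a crosspolytope, in cup product form.

To see that lambda_n is critical, no gradient flow is used. The odd continuous maps
from a given compact symmetric set A into the sphere form a complete space, on
which the maximum of Psi along the map is bounded below by the minimax level. By a
variational principle of Ekeland type some map close to the inclusion cannot be
improved at a given price, and a single pseudo-gradient step shows that it passes through
an almost critical point close to A ([almost_critical_point]). Taking sets A
of almost optimal level and using the Palais-Smale condition gives a critical point of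
value lambda_n, whose direction moreover lies in any closed set that contains all these A
([minimax_critical]).

This localisation gives the multiplicity. If lambda_n = lambda_(n+1) and finitely many
critical points are given, an odd function psi not vanishing at their directions cuts
the sets of genus n + 1 down to sets of genus n on which psi = 0, and a further
critical point appears there ([lambda_eq_critical]). If consecutive levels are all
different, there are infinitely many critical values.

If finally (lambda_n) were bounded, no finite family of functionals could be
without common zero on some sublevel set of Psi on the sphere, since such a family is an odd
map bounding the genus. One may then choose inductively points of the sublevel set
annihilated by the derivatives of the norm at the combinations of their
predecessors. Uniform convexity forces such a sequence to converge weakly to 0
([weakly_null_sequence]), which (H3) forbids. *)

(** * Simplicial chains modulo two *)
Notation "\xor_ ( i <- r ) F" := (\big[addb/false]_(i <- r) F)
  (at level 41, F at level 41, i, r at level 50).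

(** A simplex is the sequence of its vertices and a chain modulo 2 is a sequence
of simplices, tested only through sums modulo 2 of boolean functions; chains
that differ by cancelling pairs are thereby identified without a quotient. The
empty sequence is a simplex, so that the complex is augmented. *)
Section SimplicialChains.
Variable T : eqType.
Implicit Types (s t : seq T) (F : seq T -> bool).

Fixpoint facets s : seq (seq T) :=
  if s is x :: s' then s' :: map (cons x) (facets s') else [::].

Lemma facets_cons x s : facets (x :: s) = s :: map (cons x) (facets s).
Proof. by []. Qed.

Lemma facets_subseq s t : t \in facets s -> subseq t s.
Proof.
elim: s t => [|x s IH] t //=; rewrite inE => /orP[/eqP ->|/mapP[u us ->]].
  exact: subseq_cons.
by rewrite /= eqxx IH.
Qed.

Lemma facets_size s t : t \in facets s -> size t = (size s).-1.
Proof.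
elim: s t => [|x s IH] t //=; rewrite inE => /orP[/eqP -> //|/mapP[u us ->]] /=.
by rewrite (IH _ us); case: s us {IH}.
Qed.

Lemma xor_flatten (U V : Type) (f : U -> seq V) (c : seq U) (G : V -> bool) :
  \xor_(v <- flatten (map f c)) G v = \xor_(u <- c) \xor_(v <- f u) G v.
Proof. by rewrite big_flatten /= big_map. Qed.

Lemma facets_facets s F : \xor_(t <- facets s) \xor_(u <- facets t) F u = false.
Proof.
elim: s F => [|x s IH] F /=; first by rewrite big_nil.
rewrite big_cons big_map.
under [X in _ (+) X]eq_bigr do rewrite /= big_cons big_map.
by rewrite big_split /= (IH (F \o cons x)) addbF addbb.
Qed.

(** A function of simplices that ignores the order of the vertices has a sum over
facets with the same property; this is what allows a labelled simplex to be
sorted before its facets are inspected. *)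
Lemma facets_insert x s1 s2 F :
  (forall u v, perm_eq u v -> F u = F v) ->
  \xor_(t <- facets (s1 ++ x :: s2)) F t = \xor_(t <- facets (x :: s1 ++ s2)) F t.
Proof.
elim: s1 F => [//|y s1 IH] F symF /=.
rewrite !big_cons !big_map (IH (F \o cons y)); last first.
  by move=> u v uv; apply: symF; rewrite perm_cons.
rewrite /= !big_cons !big_map /=.
under [in LHS]eq_bigr => u _ do
  rewrite (symF _ [:: x, y & u]) ?(perm_catCA [:: y] [:: x] u) //.
rewrite !addbA (addbC (F (s1 ++ x :: s2))); congr (_ (+) _).
congr (_ (+) _); apply: symF.
by rewrite (perm_catCA s1 [:: x] s2).
Qed.

Lemma facets_perm s s' F : (forall u v, perm_eq u v -> F u = F v) ->
  perm_eq s s' -> \xor_(t <- facets s) F t = \xor_(t <- facets s') F t.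
Proof.
elim: s s' F => [|x s IH] s' F symF.
  by move=> /perm_size/esym/eqP; rewrite size_eq0 => /eqP ->.
move=> ss'; have : x \in s' by rewrite -(perm_mem ss') mem_head.
move=> /path.splitPr xs'; case: s' / xs' ss' => s1 s2.
rewrite facets_insert // perm_sym (perm_catCA s1 [:: x] s2) perm_cons => ss'.
rewrite /= !big_cons !big_map; congr (_ (+) _).
  by apply: symF; rewrite perm_sym.
apply: (IH _ (F \o cons x)); last by rewrite perm_sym.
by move=> u v uv; apply: symF; rewrite perm_cons.
Qed.

End SimplicialChains.

Lemma facets_map (T U : eqType) (f : T -> U) s :
  facets (map f s) = map (map f) (facets s).
Proof. by elim: s => //= x s ->; rewrite -!map_comp. Qed.

(** * Alternating labels and the parity of hemispheres *)
Section Labels.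
Notation label := (nat * bool)%type.
Implicit Types (x y : label) (L M : seq label).

Definition flip x : label := (x.1, ~~ x.2).

(** With [a] the sign of a label and [w] its coboundary, which is 1 on an edge
whose ends have opposite signs, [alternating] is the cup power of [w] and
[pos_alternating] is the cup product of [a] with the next lower power of [w]. *)
Fixpoint alternates x L : bool :=
  if L is y :: L' then (x.2 (+) y.2) && alternates y L' else true.

Definition alternating L := if L is x :: L' then alternates x L' else true.

Definition pos_alternating L := if L is x :: L' then x.2 && alternates x L' else true.

(** The cup power of a coboundary is a cocycle: this is the vanishing of its sum
over the facets of [x :: y :: L]. *)
Lemma facets_alternates x y L :
  \xor_(t <- facets (y :: L)) alternates x t = alternates y L.
Proof.
elim: L x y => [|z L IH] x y; first by rewrite /= big_cons big_nil.
rewrite facets_cons big_cons big_map.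
transitivity (alternates x (z :: L) (+) (x.2 (+) y.2) &&
   \xor_(t <- facets (z :: L)) alternates y t).
  congr (_ (+) _); rewrite big_distrr /=; exact: eq_bigr.
rewrite IH /=; by case: x.2 y.2 z.2 (alternates z L) => [] [] [] [].
Qed.

(** The coboundary of the product of [a] with a power of [w] is the next power
of [w]. *)
Lemma facets_pos_alternating L : (1 < size L)%N ->
  \xor_(t <- facets L) pos_alternating t = alternating L.
Proof.
case: L => [//|x [//|y L]] _.
rewrite facets_cons big_cons big_map.
transitivity (pos_alternating (y :: L) (+) x.2 && 
   \xor_(t <- facets (y :: L)) alternates x t).
  congr (_ (+) _); rewrite big_distrr /=; exact: eq_bigr.
rewrite facets_alternates /=.
by case: x.2 y.2 (alternates y L) => [] [] [].
Qed.

Lemma alternates_flip x L : alternates (flip x) (map flip L) = alternates x L.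
Proof. by elim: L x => //= y L IH x; rewrite IH addNb addbN negbK. Qed.

Lemma pos_alternating_flip L : (0 < size L)%N ->
  pos_alternating L (+) pos_alternating (map flip L) = alternating L.
Proof.
case: L => //= x L _; rewrite alternates_flip.
by case: x.2 (alternates x L) => [] [].
Qed.

Definition lab_le x y := (x.1 < y.1)%N || (x.1 == y.1) && (x.2 ==> y.2).

Lemma lab_le_total : total lab_le.
Proof.
by move=> [i a] [j b]; rewrite /lab_le /=; case: ltngtP => //= _; case: a b => [] [].
Qed.

Lemma lab_le_trans : transitive lab_le.
Proof.
by move=> [i a] [j b] [k c]; rewrite /lab_le /=; case: a b c => [] [] [] /=; lia.
Qed.

Lemma lab_le_anti : antisymmetric lab_le.
Proof.
move=> [i a] [j b]; rewrite /lab_le /=; case: ltngtP => //= ->.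
by case: a b => [] [].
Qed.

(** Antipodal labels never occur together in a consistent sequence. This is the
absence of complementary edges in Tucker's lemma. *)
Definition consistent L := forall x y, x \in L -> y \in L -> x.1 = y.1 -> x.2 = y.2.

Lemma consistent_perm L M : perm_eq L M -> consistent L -> consistent M.
Proof. by move=> /perm_mem LM cL x y; rewrite -!LM; apply: cL. Qed.

Lemma sort_flip L : consistent L ->
  sort lab_le (map flip L) = map flip (sort lab_le L).
Proof.
move=> cL; apply: (sorted_eq lab_le_trans lab_le_anti).
- exact: sort_sorted lab_le_total _.
- have : sorted lab_le (sort lab_le L) by exact: sort_sorted lab_le_total _.
  have : consistent (sort lab_le L) by apply: consistent_perm cL; rewrite perm_sym perm_sort.
  case: (sort _ L) => //= x M; elim: M x => //= y M IH x cM /andP[xy yM].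
  apply/andP; split; last by apply: IH => // u v uM vM; apply: cM; rewrite inE ?uM ?vM orbT.
  move: xy; rewrite /lab_le /=; case: ltngtP => //= xy _.
  by rewrite (cM x y) ?mem_head ?inE ?eqxx ?orbT // implybb.
- by rewrite perm_sort perm_map // perm_sym perm_sort.
Qed.

(** Between two neighbours with opposite signs consistency forces a strict increase
of the index, so an alternating sorted sequence has pairwise distinct indices. *)
Lemma sorted_alternating_size k L : consistent L -> sorted lab_le L ->
  (forall x, x \in L -> (x.1 < k)%N) -> alternating L -> (size L <= k)%N.
Proof.
move=> cL sL Lk aL.
have sL1 : sorted ltn (map fst L).
  case: L cL sL aL {Lk} => //= x L; elim: L x => //= y L IH x cM /andP[xy yL].
  move=> /andP[xy2 aL]; apply/andP; split.
    move: xy; rewrite /lab_le; case: ltngtP => //= xy.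
    by move: xy2; rewrite (cM x y) ?mem_head ?inE ?eqxx ?orbT // addbb.
  by apply: IH => // u v uM vM; apply: cM; rewrite inE ?uM ?vM orbT.
rewrite -(size_map fst) -(size_iota 0 k); apply: uniq_leq_size.
  exact: sorted_uniq ltn_trans ltnn _ sL1.
by move=> i /mapP[x xL ->]; rewrite mem_iota /= Lk.
Qed.

End Labels.

Section Parity.
Variables (T : eqType) (opp : T -> T) (lab : T -> nat * bool).

(** The chain [c'] is bounded by [c] and its antipode, as a hemisphere is bounded
by the two halves of the equator. *)
Definition hemisphere_boundary (c' c : seq (seq T)) := forall F : seq T -> bool,
  \xor_(s <- c') \xor_(t <- facets s) F t =
  (\xor_(s <- c) F s) (+) (\xor_(s <- c) F (map opp s)).

Definition parity (c : seq (seq T)) :=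
  \xor_(s <- c) alternating (sort lab_le (map lab s)).

(** The number of alternating simplices modulo 2 passes from a hemisphere to the
hemisphere of its equator: write each term as a sum of [pos_alternating] over
facets, move to the boundary, and pair each simplex with its antipode, for which
the two signed counts add up to the unsigned one. *)
Lemma parity_step (c' c : seq (seq T)) :
  hemisphere_boundary c' c ->
  (forall s, s \in c' -> (1 < size s)%N /\ consistent (map lab s)) ->
  (forall s, s \in c -> [/\ (0 < size s)%N, consistent (map lab s) &
      forall x, x \in s -> lab (opp x) = flip (lab x)]) ->
  parity c' = parity c.
Proof.
move=> bd gc' gc.
pose F (s : seq T) := pos_alternating (sort lab_le (map lab s)).
have sortK L : sort lab_le (sort lab_le L) = sort lab_le L.
  by apply: sorted_sort lab_le_trans _ _; exact: sort_sorted lab_le_total _.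
transitivity (\xor_(s <- c') \xor_(t <- facets s) F t).
  rewrite /parity !big_seq; apply: eq_bigr => s /gc'[s2 cs].
  pose G L := pos_alternating (sort lab_le L).
  have symG u v : perm_eq u v -> G u = G v.
    move=> uv; congr pos_alternating.
    by apply/perm_sortP => //; [exact: lab_le_total|exact: lab_le_trans|exact: lab_le_anti].
  transitivity (\xor_(t <- facets (map lab s)) G t); last by rewrite facets_map big_map.
  rewrite (@facets_perm _ _ (sort lab_le (map lab s)) G symG); last first.
    by rewrite perm_sym perm_sort.
  rewrite -facets_pos_alternating ?size_sort ?size_map //.
  rewrite !big_seq; apply: eq_bigr => t /facets_subseq st; rewrite /G sorted_sort //.
    exact: lab_le_trans.
  apply: subseq_sorted st _; first exact: lab_le_trans.
  exact: sort_sorted lab_le_total _.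
rewrite bd -big_split /= /parity !big_seq; apply: eq_bigr => s /gc[s0 cs os].
rewrite /F -map_comp; have -> : map (lab \o opp) s = map flip (map lab s).
  by rewrite -map_comp; apply/eq_in_map => x /os.
by rewrite sort_flip // pos_alternating_flip // size_sort size_map.
Qed.

End Parity.

(** * Barycentric subdivision of the hemispheres of a crosspolytope *)
Section Subdivision.
Context {R : realType} {V : normedModType R}.
Implicit Types (s t : seq V) (c : seq (seq V)) (F : seq V -> bool).

Definition barycenter s : V := (size s)%:R^-1 *: \sum_(x <- s) x.

(** The subdivision of a simplex is the cone from its barycenter over the subdivision
of its boundary; the fuel [n] is the number of vertices. *)
Fixpoint subdiv_rec n s : seq (seq V) :=
  if n is n'.+1 then
    map (cons (barycenter s)) (flatten (map (subdiv_rec n') (facets s)))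
  else [:: s].

Definition subdiv s := subdiv_rec (size s) s.

Definition subdiv_chain c := flatten (map subdiv c).

Lemma subdivE s : (0 < size s)%N ->
  subdiv s = map (cons (barycenter s)) (subdiv_chain (facets s)).
Proof.
rewrite /subdiv; case sz: (size s) => [//|n] _ /=; congr (map _ (flatten _)).
by apply/eq_in_map => t /facets_size; rewrite sz /subdiv => ->.
Qed.

(** Subdivision is a chain map. The boundary of a cone is its base plus the cone
over the boundary of the base, and that cone vanishes because the base is the
subdivision of a boundary. *)
Lemma subdiv_facets s F :
  \xor_(t <- subdiv s) \xor_(u <- facets t) F u =
  \xor_(t <- facets s) \xor_(u <- subdiv t) F u.
Proof.
elim: {s}(size s) {-2}s (erefl (size s)) F => [|n IH] s sz F.
  by move: sz => /eqP; rewrite size_eq0 => /eqP ->; rewrite /subdiv /= big_seq1 !big_nil.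
rewrite subdivE ?sz // big_map; set b := barycenter s.
under eq_bigr do rewrite facets_cons big_cons big_map.
rewrite big_split /= /subdiv_chain !xor_flatten.
rewrite [X in _ (+) X](_ : _ = false) ?addbF //.
transitivity (\xor_(t <- facets s) \xor_(u <- facets t) \xor_(v <- subdiv u) F (b :: v)).
  rewrite !big_seq; apply: eq_bigr => t /facets_size; rewrite sz /= => szt.
  exact: (IH t szt (F \o cons b)).
exact: facets_facets.
Qed.

Lemma subdiv_opp s : subdiv (map -%R s) = map (map -%R) (subdiv s).
Proof.
elim: {s}(size s) {-2}s (erefl (size s)) => [|n IH] s sz.
  by move: sz => /eqP; rewrite size_eq0 => /eqP ->.
rewrite !subdivE ?size_map ?sz // facets_map.
have -> : barycenter (map -%R s) = - barycenter s.
  by rewrite /barycenter size_map big_map sumrN scalerN.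
have -> : subdiv_chain (map (map -%R) (facets s)) =
    map (map -%R) (subdiv_chain (facets s)).
  rewrite /subdiv_chain map_flatten -!map_comp; congr flatten.
  by apply/eq_in_map => t /facets_size; rewrite sz /= => szt; rewrite IH.
by rewrite -!map_comp.
Qed.

Lemma hemisphere_subdiv c' c : hemisphere_boundary -%R c' c ->
  hemisphere_boundary -%R (subdiv_chain c') (subdiv_chain c).
Proof.
move=> bd F; rewrite /subdiv_chain !xor_flatten.
under eq_bigr do rewrite subdiv_facets.
rewrite (bd (fun t => \xor_(u <- subdiv t) F u)); congr (_ (+) _).
by apply: eq_bigr => s _; rewrite subdiv_opp big_map.
Qed.

Lemma subdiv_size s t : t \in subdiv s -> size t = size s.
Proof.
elim: {s}(size s) {-2}s (erefl (size s)) t => [|n IH] s sz t.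
  by move: sz => /eqP; rewrite size_eq0 => /eqP ->; rewrite inE => /eqP ->.
rewrite subdivE ?sz // => /mapP[u /flattenP[w /mapP[v vs ->] uv] ->] /=.
by rewrite (IH v) //; rewrite (facets_size vs) sz.
Qed.

(** Convexity in the only form that subdivision uses. It transports both the size
of simplices and their distance to the origin. *)
Definition barycentric_closed (P : V -> Prop) := forall s,
  (0 < size s)%N -> (forall x, x \in s -> P x) -> P (barycenter s).

Lemma subdiv_closed (P : V -> Prop) s : barycentric_closed P ->
  (forall x, x \in s -> P x) -> forall t, t \in subdiv s -> forall x, x \in t -> P x.
Proof.
move=> cP; elim: {s}(size s) {-2}s (erefl (size s)) => [|n IH] s sz Ps t.
  by move: sz => /eqP; rewrite size_eq0 => /eqP ->; rewrite inE => /eqP -> x.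
rewrite subdivE ?sz // => /mapP[u /flattenP[w /mapP[v vs ->] uv] ->] x.
rewrite inE => /orP[/eqP ->|xu]; first by apply: cP; rewrite ?sz.
apply: (IH v _ _ u) => //; first by rewrite (facets_size vs) sz.
by move=> y yv; apply: Ps; apply: mem_subseq (facets_subseq vs) _ yv.
Qed.

Lemma barycenter_dist s (a : V) (r : R) : (0 < size s)%N ->
  \sum_(x <- s) `|a - x| <= (size s)%:R * r -> `|a - barycenter s| <= r.
Proof.
move=> s0 sr; have s0' : (size s)%:R != 0 :> R by rewrite pnatr_eq0 -lt0n.
have -> : a - barycenter s = (size s)%:R^-1 *: \sum_(x <- s) (a - x).
  rewrite /barycenter sumrB big_const_seq count_predT iter_addr_0 scalerBr.
  by rewrite -(scaler_nat (size s) a) scalerA mulVf // scale1r.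
rewrite normrZ ger0_norm ?invr_ge0 ?ler0n // ler_pdivrMl ?ltr0n //.
by apply: le_trans sr; exact: ler_norm_sum.
Qed.

Lemma ball_barycentric_closed (a : V) (r : R) :
  barycentric_closed (fun x => `|a - x| <= r).
Proof.
move=> s s0 sr; apply: barycenter_dist => //.
rewrite (big_nth 0) mulr_natl -[in leRHS](subn0 (size s)) -sumr_const_nat.
by apply: ler_sum_nat => i /andP[_ ilt]; apply: sr; rewrite mem_nth.
Qed.

(** Averaging the distances from a vertex to all vertices, one of which is zero,
gains the factor m / (m + 1). *)
Lemma barycenter_mesh (m : nat) s (d : R) : (size s <= m.+1)%N ->
  (forall x y, x \in s -> y \in s -> `|x - y| <= d) ->
  forall x, x \in s -> `|x - barycenter s| <= m%:R / m.+1%:R * d.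
Proof.
move=> sm sd x xs; have d0 : 0 <= d by apply: le_trans (sd x x xs xs); exact: normr_ge0.
case sz : (size s) sm => [|p] sm; first by move: sz xs => /eqP; rewrite size_eq0 => /eqP ->.
apply: barycenter_dist; rewrite ?sz //.
rewrite (big_rem x) //= subrr normr0 add0r.
apply: (@le_trans _ _ (p%:R * d)).
  have -> : p = size (rem x s) by rewrite size_rem // sz.
  rewrite (big_nth 0) mulr_natl -[in leRHS](subn0 (size _)) -sumr_const_nat.
  by apply: ler_sum_nat => i /andP[_ ilt]; apply: sd => //; apply: mem_rem; exact: mem_nth.
rewrite mulrA ler_wpM2r // mulrA ler_pdivlMr ?ltr0n //.
by rewrite -!natrM ler_nat; nia.
Qed.

Definition mesh_le (d : R) s := forall x y, x \in s -> y \in s -> `|x - y| <= d.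

Lemma subdiv_mesh (m : nat) s (d : R) : (size s <= m.+1)%N -> mesh_le d s ->
  forall t, t \in subdiv s -> mesh_le (m%:R / m.+1%:R * d) t.
Proof.
elim: {s}(size s) {-2}s (erefl (size s)) => [|n IH] s sz sm sd t.
  by move: sz => /eqP; rewrite size_eq0 => /eqP ->; rewrite inE => /eqP -> x y.
have near_b := barycenter_mesh sm sd.
have d0 : 0 <= m%:R / m.+1%:R * d.
  case: (s) sz sd => // y s' _ sd.
  by rewrite !mulr_ge0 ?invr_ge0 ?ler0n //; apply: le_trans (sd y y _ _); rewrite ?mem_head.
rewrite subdivE ?sz // => /mapP[u /flattenP[w /mapP[v vs ->] uv] ->].
have bu y : y \in u -> `|barycenter s - y| <= m%:R / m.+1%:R * d.
  move: y; apply: (subdiv_closed (@ball_barycentric_closed _ _) _ uv) => y yv.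
  by rewrite distrC; apply: near_b; apply: mem_subseq (facets_subseq vs) _ yv.
have um : mesh_le (m%:R / m.+1%:R * d) u.
  apply: (IH v) => //; first by rewrite (facets_size vs) sz.
    by rewrite (facets_size vs) (leq_trans (leq_pred _)).
  by move=> x y xv yv; apply: sd; apply: mem_subseq (facets_subseq vs) _ _.
move=> x y; rewrite !inE => /orP[/eqP ->|xu] /orP[/eqP ->|yu].
- by rewrite subrr normr0.
- exact: bu.
- by rewrite distrC; exact: bu.
- exact: um.
Qed.

Lemma mem_subdiv_chain c t :
  t \in subdiv_chain c -> exists2 s, s \in c & t \in subdiv s.
Proof. by move=> /flattenP[w /mapP[s sc ->] ts]; exists s. Qed.

(** The sphere of dimension j is the suspension of its equator by the two points
[e j] and [- e j]; its upper hemisphere is the cone from [e j] over the two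
hemispheres of the equator. *)
Fixpoint hemisphere (e : nat -> V) j : seq (seq V) :=
  if j is i.+1 then
    map (cons (e j)) (hemisphere e i ++ map (map -%R) (hemisphere e i))
  else [:: [:: e 0]].

Lemma hemisphere_cycle e j F :
  \xor_(s <- hemisphere e j ++ map (map -%R) (hemisphere e j)) \xor_(t <- facets s) F t = false.
Proof.
elim: j F => [|j IH] F; first by rewrite /= !big_cons !big_nil !addbF addbb.
set z := hemisphere e j ++ _ in IH.
have zN G : \xor_(s <- z) G (map -%R s) = \xor_(s <- z) G s.
  rewrite /z !big_cat !big_map /= addbC; congr (_ (+) _); apply: eq_bigr => s _.
  by rewrite -map_comp map_id_in // => x _ /=; rewrite opprK.
rewrite [hemisphere _ _]/= -/z big_cat !big_map /=.
under eq_bigr do rewrite big_cons big_map.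
under [X in _ (+) X]eq_bigr do rewrite big_cons big_map.
rewrite !big_split /= (IH (F \o cons _)) addbF zN.
transitivity (\xor_(s <- z) F s (+) \xor_(s <- z) F s); last by rewrite addbb.
congr (_ (+) _); rewrite -[RHS]addbF; congr (_ (+) _).
rewrite -[RHS](IH (fun u => F (- e j.+1 :: u))).
exact: (zN (fun s => \xor_(t <- facets s) F (- e j.+1 :: t))).
Qed.

Lemma hemisphereP e j : hemisphere_boundary -%R (hemisphere e j.+1) (hemisphere e j).
Proof.
move=> F; rewrite [hemisphere e j.+1]/= big_map.
under eq_bigr do rewrite facets_cons big_cons big_map.
rewrite big_split /= (hemisphere_cycle e j (F \o cons (e j.+1))) addbF.
by rewrite big_cat big_map.
Qed.

Lemma hemisphere_size e j s : s \in hemisphere e j -> size s = j.+1.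
Proof.
elim: j s => [|j IH] s; first by rewrite inE => /eqP ->.
move=> /mapP[t + ->]; rewrite mem_cat => /orP[/IH /= -> //|/mapP[u /IH us ->]] /=.
by rewrite size_map us.
Qed.

Lemma hemisphere_vertices e j s : s \in hemisphere e j ->
  exists b : nat -> bool, forall x, x \in s -> exists2 i, (i <= j)%N & x = (-1) ^+ b i *: e i.
Proof.
elim: j s => [|j IH] s.
  rewrite inE => /eqP ->; exists (fun=> false) => x; rewrite inE => /eqP ->.
  by exists 0%N; rewrite // expr0 scale1r.
move=> /mapP[t ts ->].
have [b tb] : exists b : nat -> bool, forall x, x \in t -> exists2 i, (i <= j)%N & x = (-1) ^+ b i *: e i.
  move: ts; rewrite mem_cat => /orP[/IH //|/mapP[u /IH[b ub] ->]].
  exists (fun i => ~~ b i) => _ /mapP[y /ub[i ij ->] ->]; exists i => //.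
  by rewrite signrN scaleNr.
exists (fun i => if i == j.+1 then false else b i) => x; rewrite inE.
move=> /orP[/eqP ->|/tb[i ij ->]]; first by exists j.+1; rewrite ?eqxx // expr0 scale1r.
by exists i; rewrite ?(leq_trans ij) //; case: eqP => // ie; move: ij; rewrite ie ltnn.
Qed.

End Subdivision.

(** * The Borsuk-Ulam theorem *)
Lemma within_continuousP (R : realType) (V W : normedModType R) (A : set V) (f : V -> W) :
  {within A, continuous f} <->
  forall x, A x -> forall e : R, 0 < e -> exists2 d : R, 0 < d &
    forall y, A y -> `|x - y| < d -> `|f x - f y| < e.
Proof.
split=> [/subspace_continuousP cf x Ax e e0|cf].
  have /cvgrPdist_lt/(_ e e0) := cf x Ax.
  rewrite /prop_near1 /within /= => /nbhs_normP[d /= d0 dP]; exists d => // y Ay xy.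
  by apply: dP.
apply/subspace_continuousP => x Ax; apply/cvgrPdist_lt => e e0.
have [d d0 dP] := cf x Ax e e0.
by apply/nbhs_normP; exists d => //= y xy Ay; apply: dP.
Qed.

(** A property that holds near each point of a compact set for all small parameters
holds on the whole set for one parameter. *)
Lemma compact_uniform (R : realType) (V : normedModType R) (K : set V) (P : R -> V -> Prop) :
  compact K ->
  (forall x, K x -> exists2 r : R, 0 < r & forall y, K y -> `|x - y| < r ->
     forall r', 0 < r' < r -> P r' y) ->
  exists2 r : R, 0 < r & forall y, K y -> P r y.
Proof.
move=> /compact_near_coveringP cK loc.
have : \forall r \near (0 : R)^'+, K `<=` (fun y => K y -> P r y).
  apply: (cK R (0 : R)^'+ (fun r y => K y -> P r y)) => x Kx.
  have [r r0 rP] := loc x Kx.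
  exists ([set y | `|x - y| < r], [set r' | 0 < r' < r]).
    split => /=.
      by apply/nbhs_normP; exists r.
    near=> r'; apply/andP; split; near: r'; [exact: nbhs_right_gt|exact: nbhs_right_lt].
  by move=> [y r'] /= [xy r'r] Ky; apply: rP.
move=> nr; have nr0 : \forall r \near (0 : R)^'+, 0 < r by exact: nbhs_right_gt.
have [r [r0 rP]] := @filter_ex _ _ _ _ (filterI nr0 nr).
by exists r => // y Ky; apply: rP.
Unshelve. all: by end_near. Qed.

Lemma lipschitz_continuous (R : realType) (V W : normedModType R) (f : V -> W) (L : R) :
  (forall x y, `|f x - f y| <= L * `|x - y|) -> continuous f.
Proof.
move=> fL x; apply/cvgrPdist_lt => e e0; apply/nbhs_normP.
have L0 : 0 < `|L| + 1 by rewrite ltr_wpDl.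
exists (e / (`|L| + 1)) => /=; first by rewrite divr_gt0.
move=> y /= xy; apply: le_lt_trans (fL _ _) _.
move: xy; rewrite ltr_pdivlMr //; apply: le_lt_trans.
by rewrite mulrC ler_wpM2l // (le_trans (ler_norm L)) // lerDl.
Qed.

Lemma coord_le_norm (R : realType) n (x : 'rV[R]_n) i : `|x 0 i| <= `|x|.
Proof.
rewrite [ `|x|]mx_normrE.
exact: (le_bigmax _ (fun ij => `|x ij.1 ij.2|) (0, i)).
Qed.

Lemma l1_norm_continuous (R : realType) n :
  continuous (fun x : 'rV[R]_n => \sum_i `|x 0 i|).
Proof.
apply: (@lipschitz_continuous R _ R^o _ n%:R) => x y; rewrite -sumrB.
apply: le_trans (ler_norm_sum _ _ _) _.
apply: (@le_trans _ _ (\sum_(i < n) `|x - y|)).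
  apply: ler_sum => i _; apply: le_trans (ler_dist_dist _ _) _.
  by rewrite -[_ - _](_ : (x - y) 0 i = _) ?coord_le_norm // !mxE.
by rewrite sumr_const card_ord mulr_natl.
Qed.

Section BorsukUlam.
Context {R : realType}.

Definition l1_sphere n : set 'rV[R]_n := [set x | \sum_i `|x 0 i| = 1].

Lemma l1_sphere_compact n : compact (@l1_sphere n).
Proof.
apply: bounded_closed_compact.
  exists 1; split; first exact: real1.
  move=> r r1 x Sx; apply: le_trans (ltW r1).
  rewrite [ `|x|]mx_normrE; apply: bigmax_le => //= -[i j] _ /=.
  by rewrite ord1 -Sx (bigD1 j) //= lerDl sumr_ge0.
apply: (@preimage_closed _ _ (fun x : 'rV[R]_n => \sum_i `|x 0 i|) [set r | r = 1]).
  by move=> x _; exact: l1_norm_continuous.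
exact: closed_eq.
Qed.

(** The face of the crosspolytope on which the coordinates have the signs [b]. Being
convex, it contains every subdivision of its simplices, which therefore stay on
the sphere. *)
Definition orthant (b : nat -> bool) n : set 'rV[R]_n :=
  [set x | (forall i : 'I_n, 0 <= (-1) ^+ b i * x 0 i) /\ \sum_(i < n) (-1) ^+ b i * x 0 i = 1].

Lemma orthant_l1_sphere b n : @orthant b n `<=` @l1_sphere n.
Proof.
move=> x [x0 x1]; rewrite /l1_sphere /= -[RHS]x1; apply: eq_bigr => i _.
by rewrite -[RHS]ger0_norm // normrM normr_sign mul1r.
Qed.

Lemma orthant_closed b n : barycentric_closed (@orthant b n).
Proof.
move=> s s0 sP; split=> [i|].
  rewrite /barycenter mxE summxE mulrCA mulr_ge0 ?invr_ge0 ?ler0n //.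
  by rewrite mulr_sumr big_seq sumr_ge0 // => x /sP[].
rewrite /barycenter.
transitivity ((size s)%:R^-1 * \sum_(x <- s) \sum_(i < n) (-1) ^+ b i * x 0 i).
  rewrite exchange_big /= mulr_sumr; apply: eq_bigr => i _.
  by rewrite mxE summxE mulrCA -mulr_sumr.
rewrite (eq_big_seq (fun=> 1)); last by move=> x /sP[].
by rewrite big_const_seq count_predT iter_addr_0 mulVf // pnatr_eq0 -lt0n.
Qed.

(** Label a point by the index and the sign of a coordinate of its image of maximal
modulus. On a fine subdivision neighbouring points never carry opposite labels,
because the maximal modulus is bounded below. The parity of alternating simplices
is 1 in dimension 0, hence in every dimension up to n - 1, so an alternating
simplex with n vertices exists; its n labels have distinct indices below k. *)
Theorem borsuk_ulam n k (g : 'rV[R]_n -> 'rV[R]_k) :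
  {within @l1_sphere n, continuous g} ->
  (forall x, l1_sphere x -> g (- x) = - g x) ->
  (forall x, l1_sphere x -> g x != 0) ->
  (n <= k)%N.
Proof.
case: n g => [//|n] g cg og ng.
set T := @l1_sphere n.+1 in cg og ng *.
have cT : compact T by exact: l1_sphere_compact.
have [m m0 gm] : exists2 m : R, 0 < m & forall x, T x -> m <= `|g x|.
  apply: compact_uniform => // x Tx.
  have gx0 : 0 < `|g x| / 2 by rewrite divr_gt0 // normr_gt0 ng.
  have [d d0 dP] := (within_continuousP _ _).1 cg x Tx _ gx0.
  exists (Num.min d (`|g x| / 2)); first by rewrite lt_min d0 gx0.
  move=> y Ty; rewrite lt_min => /andP[xy _] r /andP[_]; rewrite lt_min => /andP[_ rg].
  have := dP y Ty xy; have := ler_distD (g y) (g x) 0; rewrite !subr0.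
  by move=> *; lra.
have [d d0 gd] : exists2 d : R, 0 < d & forall x, T x ->
    forall y, T y -> `|x - y| < d -> `|g x - g y| < m.
  apply: (@compact_uniform _ _ _ (fun d x => forall y, T y -> `|x - y| < d -> `|g x - g y| < m)) => // x Tx.
  have m2 : 0 < m / 2 by rewrite divr_gt0.
  have [d d0 dP] := (within_continuousP _ _).1 cg x Tx _ m2.
  have d2 : 0 < d / 2 by rewrite divr_gt0.
  exists (d / 2) => // y Ty xy r /andP[r0 rd] z Tz yz.
  have xy' : `|x - y| < d by lra.
  have xz : `|x - z| < d by have := ler_distD y x z; lra.
  apply: le_lt_trans (ler_distD (g x) _ _) _; rewrite [ltRHS]splitr distrC.
  by apply: ltrD; [exact: dP xy'|exact: dP xz].
pose lab (x : 'rV[R]_n.+1) : nat * bool :=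
  if [pick i | `|g x 0 i| == `|g x|] is Some i then (val i, 0 < g x 0 i) else (0%N, false).
have labP x : T x -> exists i : 'I_k, [/\ lab x = (val i, 0 < g x 0 i), `|g x 0 i| = `|g x|
    & lab (- x) = flip (lab x)].
  move=> Tx; have gx0 := ng _ Tx.
  have ex_i : exists i, `|g x 0 i| == `|g x|.
    have : mx_norm (g x) != 0 by rewrite -[mx_norm _]/(`|g x|) normr_eq0.
    move=> /mx_norm_neq0[[i j]] /= gxij; exists j; apply/eqP.
    by rewrite [RHS]gxij ord1.
  rewrite /lab og // normrN.
  rewrite (@eq_pick _ (fun i => `|(- g x) 0 i| == `|g x|) (fun i => `|g x 0 i| == `|g x|)); last first.
    by move=> i; rewrite mxE normrN.
  case: pickP => [i /eqP gi|gi]; last by case: ex_i => i; rewrite gi.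
  exists i; split => //; rewrite /flip /= mxE oppr_gt0; congr (_, _).
  have gi0 : g x 0 i != 0 by rewrite -normr_gt0 gi normr_gt0.
  by rewrite -leNgt le_eqVlt (negbTE gi0).
have lab_near x y : T x -> T y -> `|x - y| < d -> (lab x).1 = (lab y).1 -> (lab x).2 = (lab y).2.
  move=> Tx Ty xy; have [i [-> gxi _]] := labP x Tx; have [j [-> gyj _]] := labP y Ty.
  move=> /= /val_inj ij; rewrite -{j}ij in gyj *.
  have := gd _ Tx _ Ty xy; have := gm _ Tx; have := gm _ Ty; rewrite -gxi -gyj => gy gx gxy.
  have : `|g x 0 i - g y 0 i| < m.
    apply: le_lt_trans gxy; have <- : (g x - g y) 0 i = g x 0 i - g y 0 i by rewrite !mxE.
    exact: coord_le_norm.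
  move: gx gy; rewrite !ler_normr ltr_norml => /orP[gx|gx] /orP[gy|gy] /andP[g1 g2]; apply/idP/idP; lra.
(* inord is applied only to indices at most n, where it is the identity on values. *)
pose e (i : nat) : 'rV[R]_n.+1 := delta_mx 0 (inord i).
pose C N j := iter N subdiv_chain (hemisphere e j).
pose kap : R := n%:R / n.+1%:R.
have Csize N j s : s \in C N j -> size s = j.+1.
  elim: N s => [|N IH] s; first exact: hemisphere_size.
  by move=> /mem_subdiv_chain[t /IH <- /subdiv_size].
have Cbd N j : hemisphere_boundary -%R (C N j.+1) (C N j).
  by elim: N => [|N IH]; [exact: hemisphereP|exact: hemisphere_subdiv].
have Corth N j s : (j <= n)%N -> s \in C N j -> exists b, forall x, x \in s -> @orthant b n.+1 x.
  move=> jn; elim: N s => [|N IH] s.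
    move=> /hemisphere_vertices[b sb]; exists b => x /sb[i ij ->].
    have in_ : (i < n.+1)%N by exact: leq_ltn_trans ij _.
    split=> [l|].
      rewrite !mxE eqxx /=; case: eqP => [->|_]; last by rewrite !mulr0.
      by rewrite inordK // mulr1 -signr_addb addbb.
    rewrite (bigD1 (inord i)) //= !mxE !eqxx inordK // mulr1 -signr_addb addbb expr0.
    rewrite big1 ?addr0 // => l /negbTE li.
    by rewrite !mxE eqxx /= li !mulr0.
  move=> /mem_subdiv_chain[t /IH[b tb] ts]; exists b.
  exact: subdiv_closed (@orthant_closed b n.+1) tb _ ts.
have CT N j s x : (j <= n)%N -> s \in C N j -> x \in s -> T x.
  by move=> jn /(Corth _ _ _ jn)[b sb] /sb; exact: orthant_l1_sphere.
have Cmesh N j s : (j <= n)%N -> s \in C N j -> mesh_le (kap ^+ N * 2) s.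
  move=> jn; elim: N s => [|N IH] s sC.
    have T1 x : T x -> `|x| <= 1.
      move=> Tx; rewrite [ `|x|]mx_normrE; apply: bigmax_le => //= -[i l] _ /=.
      by rewrite ord1 -Tx (bigD1 l) //= lerDl sumr_ge0.
    move=> x y xs ys; have := T1 _ (CT _ _ _ _ jn sC xs); have := T1 _ (CT _ _ _ _ jn sC ys).
    have := ler_normB x y; rewrite expr0; lra.
  have [t tC ts] := mem_subdiv_chain sC.
  rewrite exprS -mulrA; apply: (subdiv_mesh _ (IH _ tC) ts).
  by rewrite (Csize _ _ _ tC).
have [N Nd] : exists N, kap ^+ N * 2 < d.
  have kap1 : `|kap| < 1.
    rewrite ger0_norm ?divr_ge0 ?ler0n // ltr_pdivrMr ?ltr0n // mul1r ltr_nat //.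
  have := cvg_expr kap1 => /cvgrPdist_lt/(_ (d / 2)).
  case; first by rewrite divr_gt0.
  move=> N _ /(_ N (leqnn N)) /=; rewrite sub0r normrN ger0_norm; last first.
    by rewrite exprn_ge0 // divr_ge0 ?ler0n.
  by move=> h; exists N; lra.
have Ccons j s : (j <= n)%N -> s \in C N j -> consistent (map lab s).
  move=> jn sC _ _ /mapP[x xs ->] /mapP[y ys ->]; apply: lab_near.
  - exact: CT sC xs.
  - exact: CT sC ys.
  - apply: le_lt_trans Nd; exact: Cmesh jn sC x y xs ys.
have par j : (j <= n)%N -> parity lab (C N j) = true.
  elim: j => [_|j IH jn].
    have -> : C N 0%N = [:: [:: e 0%N]].
      rewrite /C; elim: (N) => //= M ->.
      by rewrite /subdiv_chain /subdiv /= /barycenter /= big_seq1 invr1 scale1r.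
    by rewrite /parity big_seq1.
  rewrite (@parity_step _ -%R lab _ (C N j)) ?IH ?(ltnW jn) //.
  - by move=> s sC; rewrite (Csize _ _ _ sC); split => //; exact: Ccons sC.
  - move=> s sC; rewrite (Csize _ _ _ sC); split => //; first exact: Ccons (ltnW jn) sC.
    by move=> x xs; have [i []] := labP x (CT _ _ _ _ (ltnW jn) sC xs).
have [s sC as_] : exists2 s, s \in C N n & alternating (sort lab_le (map lab s)).
  have := par n (leqnn n); rewrite /parity => pn.
  apply/hasP; apply: contraTT isT => /hasPn nC; rewrite -pn.
  by rewrite big_seq big1 // => s /nC/negbTE.
rewrite -(Csize _ _ _ sC) -(size_map lab) -(size_sort lab_le).
apply: sorted_alternating_size as_.
- by apply: consistent_perm (Ccons _ _ (leqnn n) sC); rewrite perm_sym perm_sort.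
- exact: sort_sorted lab_le_total _.
- move=> x; rewrite mem_sort => /mapP[y ys ->].
  by have [i [-> _ _]] := labP y (CT _ _ _ _ (leqnn n) sC ys); rewrite /= ltn_ord.
Qed.

End BorsukUlam.

(** * Functionals of class C1 away from the origin *)
Section DualNorm.
Context {R : realType} {X : normedModType R}.
Implicit Types (f : X -> R) (u v w : X).

Lemma dual_norm_bound f (c : R) : scalable (f : X -> R^o) -> (dual_norm f <= c%:E)%E ->
  forall w, `|f w| <= c * `|w|.
Proof.
move=> fZ fc w; have [->|w0] := eqVneq w 0.
  by have := fZ 0 0; rewrite !scale0r => ->; rewrite !normr0 mulr0.
have nw : `|w| != 0 by rewrite normr_eq0.
have : (`|f (`|w|^-1 *: w)|%:E <= c%:E)%E.
  apply: le_trans fc; apply: ereal_sup_ubound; exists (`|w|^-1 *: w) => //=.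
  by rewrite normrZ normfV normr_id mulVf.
rewrite fZ lee_fin normrM normfV normr_id mulrC ler_pdivrMr //.
by rewrite normr_gt0.
Qed.

Lemma dual_norm_le f (c : R) : (forall w, `|w| <= 1 -> `|f w| <= c) ->
  (dual_norm f <= c%:E)%E.
Proof. by move=> fc; apply: ge_ereal_sup => _ [w /= w1 <-]; rewrite lee_fin fc. Qed.

Lemma dual_norm_ge0 f : (0 <= dual_norm f)%E.
Proof.
apply: (@le_trans _ _ `|f 0|%:E); first by rewrite lee_fin.
by apply: ereal_sup_ubound; exists 0 => //=; rewrite normr0.
Qed.

End DualNorm.

Section C1.
Context {R : realType} {X : normedModType R} (f : X -> R).
Hypothesis C1 : C1_off0 f.

Lemma C1_diff_near u (e : R) : u != 0 -> 0 < e ->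
  \forall v \near u, forall w, `|'d f v w - 'd f u w| <= e * `|w|.
Proof.
move=> u0 e0; have [du cu] := C1 u0.
have ne : nbhs 0%E [set y : \bar R | (y < e%:E)%E].
  exact: (@nbhs_open_ereal_lt _ 0 (fun=> e)).
have := cu _ ne; rewrite nbhs_filterE /= => cue.
near=> v; apply: (dual_norm_bound (f := 'd f v \- 'd f u)).
  move=> a x; transitivity (a * 'd f v x - a * 'd f u x); last by rewrite -mulrBr.
  by congr (_ - _); exact: linearZ.
by apply/ltW; near: v; exact: cue.
Unshelve. all: by end_near. Qed.

(** Continuity of the derivative in the dual norm gives joint continuity in the base
point and the direction, along an arbitrary filter. *)
Lemma C1_diff_cvg (T : Type) (F : set_system T) (FF : Filter F) (g h : T -> X) u w :
  u != 0 -> g z @[z --> F] --> u -> h z @[z --> F] --> w ->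
  'd f (g z) (h z) @[z --> F] --> 'd f u w.
Proof.
move=> u0 gu hw; apply/cvgrPdist_lt => e e0.
have e2 : 0 < e / 2 by rewrite divr_gt0.
pose c := (e / 2) / (`|w| + 1 + 1).
have w1 : 0 < `|w| + 1 + 1 by rewrite !ltr_wpDl.
have c0 : 0 < c by rewrite divr_gt0.
have dc : 'd f u (h z) @[z --> F] --> 'd f u w.
  exact: cvg_comp hw (diff_continuous (C1 u0).1 (x0 := w)).
have H : \forall z \near F, forall w, `|'d f (g z) w - 'd f u w| <= c * `|w|.
  exact: (gu _ (C1_diff_near u0 c0)).
near=> z.
have hz : `|h z| <= `|w| + 1.
  have : `|w - h z| < 1 by near: z; exact: cvgr_dist_lt.
  by have := ler_distD w (h z) 0; rewrite !subr0 (distrC (h z)) => *; lra.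
apply: le_lt_trans (ler_distD ('d f u (h z)) _ _) _; rewrite [ltRHS]splitr.
apply: ltr_leD; first by near: z; exact: cvgr_dist_lt.
rewrite distrC; apply: (@le_trans _ _ (c * `|h z|)).
  by have : forall w, `|'d f (g z) w - 'd f u w| <= c * `|w|; [near: z|apply].
rewrite /c mulrAC ler_pdivrMr // ler_wpM2l ?(ltW e2) // (le_trans hz) // lerDl //.
Unshelve. all: by end_near. Qed.

(** The directional derivative of [f] and the derivative of its restriction to a line
are limits of the same difference quotients. *)
Lemma C1_line_derive (p y : X) (s : R) : p + s *: y != 0 ->
  is_derive s 1 (fun r : R => f (p + r *: y)) ('d f (p + s *: y) y).
Proof.
move=> q0; have [dq _] := C1 q0.
have E : (fun h : R => h^-1 *: (((fun r : R => f (p + r *: y)) \o shift s) (h *: 1) -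
    (fun r : R => f (p + r *: y)) s : R^o)) =
  (fun h : R => h^-1 *: ((f \o shift (p + s *: y)) (h *: y) - f (p + s *: y) : R^o)).
  apply/funext => h /=; congr (_ *: (f _ - _)).
  by rewrite [h *: 1]mulr1 scalerDl addrCA.
split; first by rewrite /derivable E; exact: diff_derivable.
by rewrite -(deriveE y dq) /derive E.
Qed.

Lemma C1_continuous u : u != 0 -> {for u, continuous f}.
Proof. by move=> /C1[/differentiable_continuous]. Qed.

End C1.

(** * The reduced functional *)
Section NormalizedVector.
Context {R : realType} {X : normedModType R}.
Implicit Types u v : X.

Definition normalize u : X := `|u|^-1 *: u.

Lemma normalize_sphere u : u != 0 -> sphere X (normalize u).
Proof.
by move=> u0; rewrite /sphere /= normrZ normfV normr_id mulVf // normr_eq0.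
Qed.

Lemma sphere_neq0 u : sphere X u -> u != 0.
Proof. by rewrite /sphere /= -normr_eq0 => ->; exact: oner_neq0. Qed.

Lemma normalizeK u : u != 0 -> `|u| *: normalize u = u.
Proof. by move=> u0; rewrite scalerA mulfV ?scale1r // normr_eq0. Qed.

Lemma normalizeN u : normalize (- u) = - normalize u.
Proof. by rewrite /normalize normrN scalerN. Qed.

Lemma normalize_cvg (T : Type) (F : set_system T) (FF : Filter F) (g : T -> X) u :
  u != 0 -> g z @[z --> F] --> u -> normalize (g z) @[z --> F] --> normalize u.
Proof.
move=> u0 gu; apply: cvgZ => //; apply: cvgV; first by rewrite normr_eq0.
exact: cvg_norm.
Qed.

Lemma neq0_near u : u != 0 -> \forall v \near u, v != 0.
Proof.
move=> u0; apply/nbhs_normP; exists `|u| => /=; first by rewrite normr_gt0.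
by move=> v /=; apply: contraTneq => ->; rewrite subr0 ltxx.
Qed.

Lemma compact_cvg_seq (x : nat -> X) l :
  x n @[n --> \oo] --> l -> compact ([set l] `|` range x).
Proof.
move=> xl F PF Fx; have [Fl|] := pselect (cluster F l).
  by exists l; split => //; left.
move=> /existsNP[A /existsNP[B /not_implyP[FA /not_implyP[lB AB]]]].
have [N _ NB] := xl _ lB.
have fin : finite_set (x @` `I_N) by exact: finite_image (finite_II N).
have := finite_compact fin PF.
case.
  apply: filterS (filterI FA Fx) => y [Ay [yl|[n _ xny]]].
    by exfalso; apply: AB; exists y; split => //; rewrite yl; exact: nbhs_singleton.
  have [nN|Nn] := ltnP n N; first by exists n.
  by exfalso; apply: AB; exists y; split => //; rewrite -xny; exact: NB.
by move=> y [[n _ <-] cy]; exists (x n); split => //; right; exists n.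
Qed.

End NormalizedVector.

(** The value [ray_value Phi u] is invariant under positive scaling of [u], so the
reduced functional on the sphere extends to the complement of the origin. Working
with this extension replaces the tangent spaces of the sphere by the whole space. *)
Section ReducedFunctional.
Context {R : realType} {X : normedModType R} (Phi : X -> R).
Hypothesis C1 : C1_off0 Phi.
Hypothesis h1 : H1 Phi.
Implicit Types u v w : X.

Local Notation t := (ray_time Phi).
Local Notation Psi := (ray_value Phi).

Lemma ray_derive u (s : R) : s *: u != 0 ->
  is_derive s 1 (fun r : R => Phi (r *: u)) ('d Phi (s *: u) u).
Proof.
move=> su0; have := @C1_line_derive _ _ _ C1 0 u s.
rewrite add0r => /(_ su0).
by under [X in is_derive _ _ X _]funext do rewrite add0r.
Qed.

Lemma ray_scale_neq0 (s : R) u : 0 < s -> u != 0 -> s *: u != 0.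
Proof. by move=> s0 u0; rewrite scaler_eq0 negb_or gt_eqF. Qed.

Lemma ray_criticalP u (s : R) : u != 0 ->
  ray_critical Phi u s <-> 0 < s /\ 'd Phi (s *: u) u = 0.
Proof.
move=> u0; split=> -[s0 ds]; split=> //.
  have d1 := ray_derive (ray_scale_neq0 s0 u0).
  by rewrite -(@derive_val _ _ _ _ _ _ _ d1) (@derive_val _ _ _ _ _ _ _ ds).
by rewrite -ds; exact: ray_derive (ray_scale_neq0 s0 u0).
Qed.

Lemma ray_timeP u : u != 0 -> 0 < t u /\ 'd Phi (t u *: u) u = 0.
Proof.
move=> u0; apply/(ray_criticalP _ u0); case: h1 => /(_ u u0)[[s [cs _]] _] _ _.
by apply: getPex; exists s.
Qed.

Lemma ray_time_gt0 u : u != 0 -> 0 < t u.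
Proof. by move=> /ray_timeP[]. Qed.

Lemma ray_time_unique u (s : R) : u != 0 -> 0 < s -> 'd Phi (s *: u) u = 0 -> t u = s.
Proof.
move=> u0 s0 ds; case: h1 => /(_ u u0)[[s' [_ us]] _] _ _.
rewrite -(us s); last by apply/(ray_criticalP _ u0).
by apply/esym/us; apply/(ray_criticalP _ u0); exact: ray_timeP.
Qed.

Lemma ray_time_scale u (a : R) : u != 0 -> 0 < a -> t (a *: u) = t u / a.
Proof.
move=> u0 a0; have [t0 dt] := ray_timeP u0.
apply: ray_time_unique; first exact: ray_scale_neq0.
  exact: divr_gt0.
by rewrite scalerA divfK ?gt_eqF // linearZ dt; exact: scaler0.
Qed.

Lemma ray_value_scale u (a : R) : u != 0 -> 0 < a -> Psi (a *: u) = Psi u.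
Proof.
by move=> u0 a0; rewrite /ray_value ray_time_scale // scalerA divfK ?gt_eqF.
Qed.

Lemma ray_value_normalize u : u != 0 -> Psi (normalize u) = Psi u.
Proof. by move=> u0; apply: ray_value_scale; rewrite // invr_gt0 normr_gt0. Qed.

Lemma nehari_ray u : u != 0 -> nehari Phi (t u *: u).
Proof.
move=> u0; have [t0 dt] := ray_timeP u0; split; first exact: ray_scale_neq0.
by rewrite linearZ dt; exact: scaler0.
Qed.

Lemma nehari_ray_time w : nehari Phi w -> t w = 1.
Proof. by move=> [w0 dw]; apply: ray_time_unique; rewrite ?scale1r. Qed.

(** A sequence converging to [u] along which [t] is unbounded would form, with its
limit, a compact subset of the sphere that contradicts the last clause of [H1]. *)
Lemma ray_time_sphere_bounded u : sphere X u -> exists M : R,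
  \forall v \near u, sphere X v -> t v <= M.
Proof.
move=> Su; apply: contrapT => /forallNP unb.
have /choice[x xP] : forall n : nat, exists v, [/\ `|u - v| < n.+1%:R^-1, sphere X v & n%:R < t v].
  move=> n; apply: contrapT => /forallNP no; apply: (unb n%:R).
  apply/nbhs_normP; exists n.+1%:R^-1 => /=; first by rewrite invr_gt0.
  by move=> v /= uv Sv; rewrite leNgt; apply/negP => tv; apply: (no v).
have xu : x n @[n --> \oo] --> u.
  apply/cvgrPdist_lt => e e0; near=> n.
  have [uxn _ _] := xP n; apply: lt_trans uxn _; near: n.
  exact: near_infty_natSinv_lt (PosNum e0).
case: h1 => _ _ /(_ _ (compact_cvg_seq xu)) []; last first.
  move=> M tM; have [n nM] : exists n : nat, M < n%:R.
    by exists (Num.trunc M).+1; exact: truncnS_gt.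
  have [_ _ tn] := xP n; have : t (x n) <= M by apply: tM; right; exists n.
  by apply/negP; rewrite -ltNge (lt_trans nM).
by move=> v [->//|[n _ <-]]; have [] := xP n.
Unshelve. all: by end_near. Qed.

(** Near [u] the values of [t] lie in a compact interval. Off a neighbourhood of
[t u] the derivative along the ray of [u] does not vanish on that interval, and by
compactness this persists for the rays of all nearby points. *)
Lemma ray_time_sphere_cvg u : sphere X u -> forall e : R, 0 < e ->
  \forall v \near u, sphere X v -> `|t u - t v| < e.
Proof.
move=> Su e e0; have u0 := sphere_neq0 Su.
have [M uM] := ray_time_sphere_bounded Su.
case: h1 => _ [d d0 dt] _.
pose K : set R := [set s | d <= s <= M] `&` [set s | e <= `|t u - s|].
have cK : compact K.
  apply: compact_closedI.
    have -> : [set s : R | d <= s <= M] = [set` `[d, M]] by apply/seteqP; split=> s /=; rewrite in_itv.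
    exact: segment_compact.
  apply: (@preimage_closed _ _ (fun s : R => `|t u - s|) [set r | e <= r]); last exact: closed_ge.
  by move=> s _; apply: (@cvg_norm _ _ _ (nbhs s) _); apply: cvgB; [exact: cvg_cst|exact: cvg_id].
have near0 : \forall v \near u, K `<=` (fun s => 'd Phi (s *: v) v != 0).
  move/compact_near_coveringP: cK; apply => s [/andP[ds _] es].
  have s0 : 0 < s by exact: lt_le_trans ds.
  have dn0 : 'd Phi (s *: u) u != 0.
    apply: contraTneq es => /(ray_time_unique u0 s0) ->.
    by rewrite /= subrr normr0 -ltNge.
  have : 'd Phi (z.1 *: z.2) z.2 @[z --> (s, u)] --> 'd Phi (s *: u) u.
    apply: (C1_diff_cvg C1 _ (ray_scale_neq0 s0 u0)); last exact: cvg_snd.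
    by apply: cvgZ; [exact: cvg_fst|exact: cvg_snd].
  move=> /(_ _ (@neq0_near _ R^o _ dn0)) /=.
  by rewrite /near_map.
near=> v => Sv.
have /andP[dtv tvM] : d <= t v <= M.
  apply/andP; split; first exact: dt.
  by have : sphere X v -> t v <= M; [near: v|apply].
rewrite ltNge; apply/negP => ev.
have vK : K `<=` (fun s => 'd Phi (s *: v) v != 0) by near: v.
have := vK (t v); rewrite (ray_timeP (sphere_neq0 Sv)).2 eqxx => /(_ _)/wrap[]//.
by split => //=; rewrite dtv.
Unshelve. all: by end_near. Qed.

Lemma ray_time_cvg (T : Type) (F : set_system T) (FF : Filter F) (g : T -> X) u :
  u != 0 -> g z @[z --> F] --> u -> t (g z) @[z --> F] --> t u.
Proof.
move=> u0 gu.
have tE v : v != 0 -> t v = t (normalize v) / `|v|.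
  move=> v0; rewrite /normalize ray_time_scale ?invr_gt0 ?normr_gt0 //.
  by rewrite invrK mulfK // normr_eq0.
have ng := normalize_cvg FF u0 gu.
have gn0 : \forall z \near F, g z != 0 by exact: (gu _ (neq0_near u0)).
rewrite (tE u u0).
have : t (normalize (g z)) / `|g z| @[z --> F] --> t (normalize u) / `|u|.
  apply: cvgM; last by apply: cvgV; [rewrite normr_eq0|exact: cvg_norm].
  apply/cvgrPdist_lt => e e0.
  have Su := normalize_sphere u0.
  have H : \forall z \near F, sphere X (normalize (g z)) ->
      `|t (normalize u) - t (normalize (g z))| < e.
    exact: (ng _ (ray_time_sphere_cvg Su e0)).
  near=> z; have := near H z; apply => //.
  by apply: normalize_sphere; near: z.
apply: cvg_trans; apply: near_eq_cvg; near=> z; apply/esym/tE.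
by near: z.
Unshelve. all: by end_near. Qed.

Lemma ray_value_cvg (T : Type) (F : set_system T) (FF : Filter F) (g : T -> X) u :
  u != 0 -> g z @[z --> F] --> u -> Psi (g z) @[z --> F] --> Psi u.
Proof.
move=> u0 gu; have tu0 := ray_scale_neq0 (ray_time_gt0 u0) u0.
apply: (cvg_comp (fun z => t (g z) *: g z) Phi _ (C1_continuous C1 tu0)).
by apply: cvgZ => //; exact: ray_time_cvg.
Qed.

(** The derivative of the reduced functional at [u] in the direction [v]: the variation
of [t] does not contribute, since the derivative along the ray vanishes. *)
Definition reduced_diff u v : R := t u * 'd Phi (t u *: u) v.

Lemma reduced_diff_cvg (T : Type) (F : set_system T) (FF : Filter F) (g h : T -> X) u v :
  u != 0 -> g z @[z --> F] --> u -> h z @[z --> F] --> v ->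
  reduced_diff (g z) (h z) @[z --> F] --> reduced_diff u v.
Proof.
move=> u0 gu hv; have tu0 := ray_scale_neq0 (ray_time_gt0 u0) u0.
have tgu := ray_time_cvg FF u0 gu.
by apply: cvgM => //; apply: C1_diff_cvg => //; exact: cvgZ.
Qed.

End ReducedFunctional.

(** * Descent directions of the reduced functional *)
Section Descent.
Context {R : realType} {X : normedModType R} (Phi : X -> R).
Hypothesis C1 : C1_off0 Phi.
Hypothesis h1 : H1 Phi.
Implicit Types u v w : X.

Local Notation t := (ray_time Phi).
Local Notation Psi := (ray_value Phi).
Local Notation G := (reduced_diff Phi).

Definition ray_max u := forall s : R, 0 < s -> Phi (s *: u) <= Psi u.
Definition ray_min u := forall s : R, 0 < s -> Psi u <= Phi (s *: u).

Lemma ray_extremum_half u (c : R) : u != 0 -> 0 < c ->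
  is_derive c 1 (fun r : R => Phi (r *: u)) 0 -> c = t u.
Proof.
move=> u0 c0 dc; apply/esym/(ray_time_unique C1 h1) => //.
by apply: (proj2 (iffLR (ray_criticalP C1 c u0) _)); split.
Qed.

(** A global extremum attained twice on a ray would give a second critical point. *)
Lemma ray_max_strict u : u != 0 -> ray_max u -> Phi ((t u / 2) *: u) < Psi u.
Proof.
move=> u0 mu; have t0 := ray_time_gt0 C1 h1 u0; have t20 : 0 < t u / 2 by rewrite divr_gt0.
rewrite lt_neqAle mu // andbT; apply/eqP => e.
suff : t u / 2 = t u by lra.
apply: ray_extremum_half => //.
apply: (@derive1_at_max _ _ 0 (t u)); rewrite ?(ltW t0) //.
- move=> r; rewrite in_itv /= => /andP[r0 _].
  exact: (@ex_derive _ _ _ _ _ _ _ (ray_derive C1 (ray_scale_neq0 r0 u0))).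
- by rewrite in_itv /= t20 /=; lra.
- by move=> r; rewrite in_itv /= => /andP[r0 _]; rewrite e; exact: mu.
Qed.

Lemma ray_min_strict u : u != 0 -> ray_min u -> Psi u < Phi ((t u / 2) *: u).
Proof.
move=> u0 mu; have t0 := ray_time_gt0 C1 h1 u0; have t20 : 0 < t u / 2 by rewrite divr_gt0.
rewrite lt_neqAle mu // andbT; apply/eqP => e.
suff : t u / 2 = t u by lra.
apply: ray_extremum_half => //.
apply: (@derive1_at_min _ _ 0 (t u)); rewrite ?(ltW t0) //.
- move=> r; rewrite in_itv /= => /andP[r0 _].
  exact: (@ex_derive _ _ _ _ _ _ _ (ray_derive C1 (ray_scale_neq0 r0 u0))).
- by rewrite in_itv /= t20 /=; lra.
- by move=> r; rewrite in_itv /= => /andP[r0 _]; rewrite -e; exact: mu.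
Qed.

(** The comparison of the value at [t u] with the value at half that time is strict
and continuous, so a ray of minimum type and a ray of maximum type are not close
to each other. *)
Lemma ray_type_near u0 : u0 != 0 ->
  (\forall u \near u0, ~ ray_min u) \/ (\forall u \near u0, ~ ray_max u).
Proof.
move=> u00; have t0 := ray_time_gt0 C1 h1 u00; have t20 : 0 < t u0 / 2 by rewrite divr_gt0.
have cvg1 : Phi ((t u0 / 2) *: u) @[u --> u0] --> Phi ((t u0 / 2) *: u0).
  apply: (cvg_comp (fun u => (t u0 / 2) *: u) Phi _ (C1_continuous C1 (ray_scale_neq0 t20 u00))).
  by apply: cvgZ; [exact: cvg_cst|exact: cvg_id].
have cvg2 := ray_value_cvg C1 h1 (nbhs_filter u0) u00 (@cvg_id _ (nbhs u0)).
case: h1 => /(_ u0 u00)[_ [mu|mu]] _ _; [left|right].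
  have lt1 := ray_max_strict u00 mu.
  pose m := (Phi ((t u0 / 2) *: u0) + Psi u0) / 2.
  near=> u => mu'; have := mu' _ t20; apply/negP; rewrite -ltNge.
  apply: (@lt_trans _ _ m).
    near: u; apply: (cvgr_lt _ cvg1); rewrite /m; lra.
  near: u; apply: (cvgr_gt _ cvg2); rewrite /m; lra.
have lt1 := ray_min_strict u00 mu.
pose m := (Phi ((t u0 / 2) *: u0) + Psi u0) / 2.
near=> u => mu'; have := mu' _ t20; apply/negP; rewrite -ltNge.
apply: (@lt_trans _ _ m).
  near: u; apply: (cvgr_lt _ cvg2); rewrite /m; lra.
near: u; apply: (cvgr_gt _ cvg1); rewrite /m; lra.
Unshelve. all: by end_near. Qed.

Lemma segment_descent (tau b s : R) u v : 0 < s ->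
  (forall r : R, 0 <= r <= s -> tau *: (u + r *: v) != 0 /\
     tau * 'd Phi (tau *: (u + r *: v)) v < - b) ->
  Phi (tau *: (u + s *: v)) <= Phi (tau *: u) - s * b.
Proof.
move=> s0 H; pose f (r : R) := Phi (tau *: u + r *: (tau *: v)).
have fE r : f r = Phi (tau *: (u + r *: v)) by rewrite /f scalerDr !scalerA mulrC.
have pE r : tau *: (u + r *: v) = tau *: u + r *: (tau *: v) by rewrite scalerDr !scalerA mulrC.
have df (r : R) : 0 <= r <= s -> is_derive r 1 f (tau * 'd Phi (tau *: (u + r *: v)) v).
  move=> rs; have [p0 _] := H r rs.
  have := @C1_line_derive _ _ _ C1 (tau *: u) (tau *: v) r.
  by rewrite -pE linearZ; apply.
have [||c] := @MVT_segment _ f (fun r => tau * 'd Phi (tau *: (u + r *: v)) v) 0 s (ltW s0).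
- by move=> r; rewrite in_itv /= => /andP[r0 rs]; apply: df; rewrite !ltW.
- apply: derivable_within_continuous => r; rewrite in_itv /= => rs.
  exact: (@ex_derive _ _ _ _ _ _ _ (df r rs)).
rewrite in_itv /= => cs; rewrite subr0 !fE scale0r addr0 => eqf.
have := (H c cs).2; rewrite -(ltr_pM2r s0) -eqf => *.
by lra.
Qed.

(** Uniform decrease of the reduced functional in a descent direction, obtained
without differentiating [t]. If the ray of [u] is of maximum type, compare the two
values at the time of [u + s *: v]; if the ray of [u + s *: v] is of minimum
type, compare them at the time of [u]. In each case only one ray is moved by a
segment at fixed time, where the mean value theorem applies. The remaining
combination of types is excluded near [u0]. *)
Lemma descent_near u0 v0 (b : R) : u0 != 0 -> G u0 v0 < - b ->
  exists2 r : R, 0 < r & forall u v (s : R), `|u0 - u| < r -> `|v0 - v| < r -> 0 < s < r ->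
    u + s *: v != 0 /\ Psi (u + s *: v) <= Psi u - s * b.
Proof.
move=> u00 Gb; have t0 := ray_time_gt0 C1 h1 u00.
have tu0 := ray_scale_neq0 t0 u00.
pose p (z : R * X * X * R) : X := z.1.1.1 *: (z.1.1.2 + z.2 *: z.1.2).
have pcvg : p z @[z --> (t u0, u0, v0, 0 : R)] --> t u0 *: u0.
  rewrite -[X in _ --> _ *: X]addr0 -[X in _ --> _ *: (_ + X)](scale0r v0).
  apply: cvgZ; first exact: (cvg_comp _ _ (cvg_comp _ _ cvg_fst cvg_fst) cvg_fst).
  apply: cvgD; first exact: (cvg_comp _ _ (cvg_comp _ _ cvg_fst cvg_fst) cvg_snd).
  by apply: cvgZ; [exact: cvg_snd|exact: (cvg_comp _ _ cvg_fst cvg_snd)].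
have dcvg : z.1.1.1 * 'd Phi (p z) z.1.2 @[z --> (t u0, u0, v0, 0 : R)] --> G u0 v0.
  apply: cvgM; first exact: (cvg_comp _ _ (cvg_comp _ _ cvg_fst cvg_fst) cvg_fst).
  apply: (C1_diff_cvg C1 _ tu0 pcvg); exact: (cvg_comp _ _ cvg_fst cvg_snd).
have : \forall z \near (t u0, u0, v0, 0 : R),
    p z != 0 /\ z.1.1.1 * 'd Phi (p z) z.1.2 < - b.
  near=> z; split; near: z; first exact: (pcvg _ (neq0_near tu0)).
  exact: (cvgr_lt _ dcvg).
move=> /nbhs_ballP[d /= d0 dP].
have tc := ray_time_cvg C1 h1 (nbhs_filter u0) u00 (@cvg_id _ (nbhs u0)).
have : \forall u \near u0, `|t u0 - t u| < d /\ u != 0.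
  by near=> u; split; near: u; [exact: cvgr_dist_lt|exact: neq0_near].
have types : exists P : set X, nbhs u0 P /\
    (forall u u', P u -> P u' -> ray_min u -> ray_max u' -> False).
  have [n|n] := ray_type_near u00; eexists; (split; first exact: n) => u u' /=.
    by move=> nu _ /nu.
  by move=> _ nu' _ /nu'.
have [P [nP PP]] := types.
move=> nQ; have [e /= e0 eP] := iffLR (nbhs_normP _ _) (filterI nP nQ).
(* The radius keeps u and u + s *: v in the ball of radius e around u0, and s below d. *)
pose L := 2 * (`|v0| + 1).
have L0 : 0 < L by rewrite mulr_gt0 // ltr_wpDl.
have e2 : 0 < e / 2 by rewrite divr_gt0.
exists (Num.min 1 (Num.min d (Num.min (e / 2) (e / L)))).
  by rewrite !lt_min ltr01 d0 e2 divr_gt0.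
move=> u v s; rewrite !lt_min => /and4P[_ ud ue _] /and4P[v1 vd _ _] /andP[s0 /and4P[s1 sd _ seL]].
have ve : `|v| <= `|v0| + 1.
  by have := ler_distD v0 v 0; rewrite !subr0 (distrC v) => *; lra.
have [Pu [tud un0]] : (P `&` [set u | `|t u0 - t u| < d /\ u != 0]) u.
  by apply: eP => /=; lra.
have [Pu' [tud' un0']] : (P `&` [set u | `|t u0 - t u| < d /\ u != 0]) (u + s *: v).
  apply: eP => /=.
  have : `|s *: v| < e / 2.
    rewrite normrZ gtr0_norm //; apply: (@le_lt_trans _ _ (s * (`|v0| + 1))).
      by rewrite ler_wpM2l // ltW.
    by move: seL; rewrite ltr_pdivlMr // /L => *; lra.
  have := ler_normB (u0 - u) (s *: v); rewrite opprD addrA => *; lra.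
split => //.
have desc tau : `|t u0 - tau| < d -> Phi (tau *: (u + s *: v)) <= Phi (tau *: u) - s * b.
  move=> td; apply: segment_descent => // r /andP[r0 rs].
  have [] := dP (tau, u, v, r); last by [].
  rewrite /ball /= /prod_ball /=; split; last first.
    by rewrite -ball_normE /= sub0r normrN ger0_norm //; lra.
  split; last by rewrite -ball_normE.
  by split; rewrite -ball_normE.
case: h1 => /(_ u un0)[_ [mu|mu]] _ _.
  apply: le_trans (desc _ tud') _; rewrite lerB // mu //.
  exact: (ray_time_gt0 C1 h1 un0').
case: h1 => /(_ _ un0')[_ [mu'|mu']] _ _; first by exfalso; exact: (PP u (u + s *: v)).
apply: le_trans (desc _ tud); apply: mu'.
exact: (ray_time_gt0 C1 h1 un0).
Unshelve. all: by end_near. Qed.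

Lemma reduced_diff_eq0 u : u != 0 -> (forall v, G u v = 0) ->
  critical_points Phi (t u *: u).
Proof.
move=> u0 G0; have t0 := ray_time_gt0 C1 h1 u0; split; first exact: ray_scale_neq0.
move=> v; have /eqP := G0 v; rewrite mulf_eq0 gt_eqF //= => /eqP ->//.
Qed.

Lemma minimizer_critical u : sphere X u -> (forall v, sphere X v -> Psi u <= Psi v) ->
  critical_points Phi (t u *: u).
Proof.
move=> Su minu; have u0 := sphere_neq0 Su; apply: reduced_diff_eq0 => //.
have G0 v : 0 <= G u v.
  rewrite leNgt; apply/negP => Gv.
  have [r r0 rP] := @descent_near u v (- G u v / 2) u0 (ltac:(lra)).
  have [|||w0 le] := rP u v (r / 2); rewrite ?subrr ?normr0 //.
    by apply/andP; split; lra.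
  have := minu _ (normalize_sphere w0); rewrite (ray_value_normalize C1 h1 w0).
  have : 0 < r / 2 * (- G u v / 2) by rewrite mulr_gt0; lra.
  by lra.
move=> v; apply/eqP; rewrite eq_le G0 andbT.
have := G0 (- v); rewrite /reduced_diff linearN mulrN; lra.
Qed.

End Descent.

(** * A variational principle for odd maps into the sphere *)
(** The ordering principle of Brezis and Browder: descend greedily, at each step
almost minimising [J] among the elements below; a lower bound of the resulting
sequence cannot be improved any more. *)
Lemma brezis_browder (R : realType) (T : Type) (D : set T) (le : T -> T -> Prop)
    (J : T -> R) (m : R) :
  (forall x, D x -> le x x) ->
  (forall x y z, D x -> D y -> D z -> le x y -> le y z -> le x z) ->
  (forall x y, D x -> D y -> le x y -> J x <= J y) ->
  (forall x, D x -> m <= J x) ->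
  (forall x : nat -> T, (forall n, D (x n)) -> (forall n, le (x n.+1) (x n)) ->
     exists2 y, D y & forall n, le y (x n)) ->
  forall x0, D x0 -> exists x, [/\ D x, le x x0 &
    forall y, D y -> le y x -> J x <= J y].
Proof.
move=> refl_le trans_le J_le J_ge chain x0 Dx0.
have step (xn : T * nat) : exists y, D xn.1 -> [/\ D y, le y xn.1 &
    forall z, D z -> le z xn.1 -> J y <= J z + xn.2.+1%:R^-1].
  case: xn => x n; have [Dx|nDx] := pselect (D x); last by exists x.
  pose E := [set J z | z in [set z | D z /\ le z x]].
  have Ex : E (J x) by exists x => //; split => //; exact: refl_le.
  have lE : has_lbound E by exists m => _ [z [Dz _] <-]; exact: J_ge.
  have n0 : 0 < n.+1%:R^-1 :> R by rewrite invr_gt0.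
  have [_ [y [Dy yx] <-] Jy] := inf_adherent n0 (conj (ex_intro _ _ Ex) lE).
  exists y => _; split => // z Dz zx; apply: le_trans (ltW Jy) _.
  by rewrite lerD2r; apply: ge_inf => //; exists z.
have [f fP] := choice step.
pose x := fix x n := if n is n'.+1 then f (x n', n') else x0.
have Dx n : D (x n) by elim: n => [//|n IH]; have [] := fP (x n, n) IH.
have xle n : le (x n.+1) (x n) by have [] := fP (x n, n) (Dx n).
have [y Dy yx] := chain x Dx xle.
exists y; split => //; first exact: (yx 0%N).
move=> z Dz zy; apply/ler_addgt0Pr => e e0.
have [n ne] : exists n : nat, n.+1%:R^-1 < e.
  have [N _ NP] := near_infty_natSinv_lt (PosNum e0).
  by exists N; apply: (NP N) => /=.
apply: (@le_trans _ _ (J (x n.+1))); first exact: J_le.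
have [_ _ /(_ z Dz)] := fP (x n, n) (Dx n).
have zxn : le z (x n) by apply: (trans_le z y) => //.
by move=> /(_ zxn) /le_trans; apply; rewrite lerD2l ltW.
Qed.

Lemma cauchy_seq_cvg (R : realType) (V : completeNormedModType R) (x : nat -> V) :
  (forall e : R, 0 < e -> exists N, forall n, (N <= n)%N -> `|x N - x n| < e) ->
  cvg (x n @[n --> \oo]).
Proof.
move=> cx; apply: cauchy_cvg; apply: cauchy_exP => e e0.
have [N NP] := cx e e0; exists (x N); exists N => // n /= Nn.
by rewrite -ball_normE; exact: NP.
Qed.

(** Deformations of [A] are recorded as odd continuous maps into the sphere, rather
than through their images: the genus does not decrease along such a map, and
uniform limits are easy to form. *)
Definition odd_sphere_map (R : realType) (X : normedModType R) (A : set X) (h : X -> X) :=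
  [/\ {within A, continuous h}, forall a, A a -> h (- a) = - h a &
      forall a, A a -> sphere X (h a)].

Section OddSphereMaps.
Context {R : realType} {X : completeNormedModType R} (Phi : X -> R).
Hypothesis C1 : C1_off0 Phi.
Hypothesis h1 : H1 Phi.
Implicit Types (u v w : X) (A : set X) (h : X -> X).

Local Notation Psi := (ray_value Phi).

Definition max_level A h : R := sup [set Psi (h a) | a in A].

Lemma max_levelP A h : compact A -> A !=set0 -> odd_sphere_map A h ->
  (exists2 a, A a & Psi (h a) = max_level A h) /\
  forall a, A a -> Psi (h a) <= max_level A h.
Proof.
move=> cA A0 [ch oh sh].
have cPh : {within A, continuous (Psi \o h)}.
  apply/subspace_continuousP => a Aa; apply: (ray_value_cvg C1 h1).
    exact: sphere_neq0 (sh _ Aa).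
  by move/subspace_continuousP: ch; apply.
have [a Aa amax] := compact_EVT_max A0 cA cPh; rewrite in_setE in Aa.
have ub : ubound [set Psi (h a) | a in A] (Psi (h a)).
  by move=> _ [b Ab <-]; apply: amax; rewrite in_setE.
have hs : has_sup [set Psi (h a) | a in A].
  by split; [exists (Psi (h a)); exists a|exists (Psi (h a))].
have ub' b : A b -> Psi (h b) <= max_level A h.
  by move=> Ab; apply: sup_upper_bound => //; exists b.
split => //; exists a => //; apply/eqP; rewrite eq_le ub' //=.
by apply: sup_le_ub => //; exists (Psi (h a)); exists a.
Qed.

(** Ekeland's order: the distance moved is paid for by the decrease of the maximal
level, at the price [b]. *)
Definition flow_le (b : R) A h' h :=
  forall a, A a -> b * `|h a - h' a| <= max_level A h - max_level A h'.

(** A descending sequence is uniformly Cauchy, since the levels converge, and its limit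
has level at most the limit of the levels, because the reduced functional is
continuous and the maximum is attained. *)
Lemma flow_le_chain (b c : R) A (h : nat -> X -> X) : compact A -> A !=set0 -> 0 < b ->
  (forall n, odd_sphere_map A (h n)) ->
  (forall n, c <= max_level A (h n)) ->
  (forall n, flow_le b A (h n.+1) (h n)) ->
  exists2 h', odd_sphere_map A h' & forall n, flow_le b A h' (h n).
Proof.
move=> cA A0 b0 oh ch hle.
pose J n := max_level A (h n).
have [a0 Aa0] := A0.
have J_dec n m : (n <= m)%N -> forall a, A a -> b * `|h n a - h m a| <= J n - J m.
  move=> /subnK <-; elim: (m - n)%N => [|k IH] a Aa; first by rewrite !subrr normr0 mulr0.
  have := IH a Aa; have := hle (k + n)%N a Aa; rewrite addSn -/(J _) -/(J _).
  have := ler_distD (h (k + n)%N a) (h n a) (h (k + n).+1 a).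
  rewrite -(ler_pM2l b0) mulrDr => *; lra.
have J_mono n m : (n <= m)%N -> J m <= J n.
  by move=> nm; rewrite -subr_ge0; apply: le_trans (J_dec _ _ nm _ Aa0); rewrite mulr_ge0 // ltW.
have lJ : has_lbound (range J) by exists c => _ [n _ <-]; exact: ch.
have Jcvg := nonincreasing_cvgn (J_mono : nonincreasing_seq J) lJ.
set L := inf _ in Jcvg.
have LJ n : L <= J n by apply: ge_inf => //; exists n.
have hcvg a : A a -> cvg (h n a @[n --> \oo]).
  move=> Aa; apply: cauchy_seq_cvg => e e0.
  have be : 0 < b * e by rewrite mulr_gt0.
  have /cvgrPdist_lt/(_ _ be)[N _ NP] := Jcvg.
  exists N => n Nn; rewrite -(ltr_pM2l b0); apply: le_lt_trans (J_dec _ _ Nn _ Aa) _.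
  have := NP N (leqnn N); rewrite /= distrC => /(le_lt_trans (ler_norm _)).
  by have := LJ n; lra.
pose k a := lim (h n a @[n --> \oo]).
have kP a : A a -> h n a @[n --> \oo] --> k a by exact: hcvg.
have k_near n a : A a -> b * `|h n a - k a| <= J n - L.
  move=> Aa; apply: (@ler_cvg_to _ (\oo : set_system nat) _ _ (fun m => b * `|h n a - h m a|) (fun m => J n - J m)).
  - apply: cvgM; first exact: cvg_cst.
    by apply: cvg_norm; apply: cvgB; [exact: cvg_cst|exact: kP].
  - by apply: cvgB => //; exact: cvg_cst.
  - by exists n => // m /= nm; exact: J_dec.
have ok : odd_sphere_map A k.
  split.
  - apply/within_continuousP => x Ax e e0.
    have be : 0 < b * (e / 3) by rewrite mulr_gt0 // divr_gt0.
    have /cvgrPdist_lt/(_ _ be)[N _ NP] := Jcvg.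
    have JN : J N - L < b * (e / 3).
      by have := NP N (leqnn N); rewrite /= distrC => /(le_lt_trans (ler_norm _)).
    have kN y : A y -> `|h N y - k y| < e / 3.
      by move=> Ay; rewrite -(ltr_pM2l b0); apply: le_lt_trans JN; exact: k_near.
    have [chN _ _] := oh N; have e3 : 0 < e / 3 by rewrite divr_gt0.
    have [d d0 dP] := (within_continuousP _ _).1 chN x Ax _ e3.
    exists d => // y Ay xy; have := dP y Ay xy; have := kN x Ax; have := kN y Ay.
    have := ler_distD (h N x) (k x) (k y); have := ler_distD (h N y) (h N x) (k y).
    by rewrite (distrC (k x) (h N x)) => *; lra.
  - move=> a Aa; have kNa : h n (- a) @[n --> \oo] --> - k a.
      under eq_fun => n do rewrite (let: And3 _ o _ := oh n in o a Aa).
      by apply: cvgN; exact: kP.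
    exact: cvg_lim kNa.
  - move=> a Aa; have : `|h n a| @[n --> \oo] --> `|k a| by apply: cvg_norm; exact: kP.
    have hn n : `|h n a| = 1 by have [_ _ /(_ a Aa)] := oh n.
    move=> hk; rewrite /sphere /=; apply/eqP; rewrite eq_le; apply/andP; split.
      by apply: (cvgr_to_le hk); exists 0%N => // n _; rewrite hn.
    by apply: (cvgr_to_ge hk); exists 0%N => // n _; rewrite hn.
have JkL : max_level A k <= L.
  have [[a Aa <-] _] := max_levelP cA A0 ok.
  have [_ _ sk] := ok.
  apply: (@ler_cvg_to _ (\oo : set_system nat) _ _ (fun n => Psi (h n a)) J) => //.
    by apply: (ray_value_cvg C1 h1); [exact: sphere_neq0 (sk _ Aa)|exact: kP].
  by exists 0%N => // n _; have [_] := max_levelP cA A0 (oh n); apply.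
exists k => // n a Aa; apply: le_trans (k_near n a Aa) _.
by rewrite lerB.
Qed.

Lemma flow_minimal (b c : R) A h0 : compact A -> A !=set0 -> 0 < b ->
  (forall h, odd_sphere_map A h -> c <= max_level A h) -> odd_sphere_map A h0 ->
  exists h, [/\ odd_sphere_map A h, flow_le b A h h0 &
    forall h', odd_sphere_map A h' -> flow_le b A h' h -> max_level A h <= max_level A h'].
Proof.
move=> cA A0 b0 ch oh0; have [a0 Aa0] := A0.
apply: (@brezis_browder R _ (odd_sphere_map A) (flow_le b A) (max_level A) c) => //.
- by move=> h _ a _; rewrite !subrr normr0 mulr0.
- move=> h k l _ _ _ hk kl a Aa; have := hk a Aa; have := kl a Aa.
  by have := ler_distD (k a) (l a) (h a); rewrite -(ler_pM2l b0) mulrDr => *; lra.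
- move=> h k _ _ hk; rewrite -subr_ge0; apply: le_trans (hk _ Aa0).
  by rewrite mulr_ge0 // ltW.
- by move=> h oh hle; apply: flow_le_chain hle => // n; exact: ch.
Qed.

End OddSphereMaps.


(** * A minimax principle without a flow *)
Section ReducedDiffLinear.
Context {R : realType} {X : normedModType R} (Phi : X -> R) (u : X).

Lemma reduced_diffZ (a : R) v : reduced_diff Phi u (a *: v) = a * reduced_diff Phi u v.
Proof. by rewrite /reduced_diff linearZ; exact: mulrCA. Qed.

Lemma reduced_diffD v w :
  reduced_diff Phi u (v + w) = reduced_diff Phi u v + reduced_diff Phi u w.
Proof. by rewrite /reduced_diff linearD mulrDr. Qed.

Lemma reduced_diff_sum (I : Type) (r : seq I) (v : I -> X) :
  reduced_diff Phi u (\sum_(i <- r) v i) = \sum_(i <- r) reduced_diff Phi u (v i).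
Proof. by rewrite /reduced_diff linear_sum mulr_sumr. Qed.

End ReducedDiffLinear.

Section EvenFunctional.
Context {R : realType} {X : normedModType R} (Phi : X -> R).
Hypothesis C1 : C1_off0 Phi.
Hypothesis h1 : H1 Phi.
Hypothesis evenPhi : even_off0 Phi.
Implicit Types u v w : X.

Lemma evenE u : Phi (- u) = Phi u.
Proof. by have [->|u0] := eqVneq u 0; [rewrite oppr0|exact: evenPhi]. Qed.

Lemma even_diff u v : u != 0 -> 'd Phi (- u) (- v) = 'd Phi u v.
Proof.
move=> u0; have [du _] := C1 u0.
have Nu0 : - u != 0 by rewrite oppr_eq0.
have [dNu _] := C1 Nu0.
rewrite -(deriveE v du) -(deriveE (- v) dNu) /derive.
suff -> : (fun r : R => r^-1 *: ((Phi \o shift (- u)) (r *: - v) - Phi (- u) : R^o)) =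
  (fun r : R => r^-1 *: ((Phi \o shift u) (r *: v) - Phi u : R^o)) by [].
by apply/funext => r /=; rewrite scalerN -opprD !evenE.
Qed.

Lemma even_ray_time u : u != 0 -> ray_time Phi (- u) = ray_time Phi u.
Proof.
move=> u0; have [t0 dt] := ray_timeP C1 h1 u0.
apply: (ray_time_unique C1 h1) => //; first by rewrite oppr_eq0.
by rewrite scalerN even_diff // ray_scale_neq0.
Qed.

Lemma even_ray_value u : u != 0 -> ray_value Phi (- u) = ray_value Phi u.
Proof. by move=> u0; rewrite /ray_value even_ray_time // scalerN evenE. Qed.

Lemma even_reduced_diff u v : u != 0 ->
  reduced_diff Phi (- u) (- v) = reduced_diff Phi u v.
Proof.
move=> u0; rewrite /reduced_diff even_ray_time // scalerN even_diff //.
exact: ray_scale_neq0 (ray_time_gt0 C1 h1 u0) u0.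
Qed.

End EvenFunctional.

Lemma within_near (R : realType) (X : normedModType R) (A : set X) (x : X) (P : set X) :
  (\forall y \near within A (nbhs x), P y) ->
  exists2 d : R, 0 < d & forall y, A y -> `|x - y| < d -> P y.
Proof.
move=> nP; have [d /= d0 dP] := iffLR (nbhs_normP x (fun y => A y -> P y)) nP.
by exists d => // y Ay xy; exact: dP.
Qed.

Lemma symmetric_setN (R : realType) (X : normedModType R) (A : set X) :
  symmetric_set A -> forall a, A a -> A (- a).
Proof. by move=> sA a Aa; rewrite -sA; exists a. Qed.

Section MinimaxPrinciple.
Context {R : realType} {X : completeNormedModType R} (Phi : X -> R).
Hypothesis C1 : C1_off0 Phi.
Hypothesis h1 : H1 Phi.
Hypothesis evenPhi : even_off0 Phi.
Variable A : set X.
Hypothesis cA : compact A.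
Hypothesis A0 : A !=set0.
Hypothesis symA : symmetric_set A.
Implicit Types (u v w : X) (h : X -> X).

Local Notation Psi := (ray_value Phi).
Local Notation G := (reduced_diff Phi).
Local Notation J := (max_level Phi A).

Lemma normalize_dist u w (d : R) : sphere X u -> `|u - w| <= d ->
  `|u - normalize w| <= 2 * d.
Proof.
move=> Su uw; have [w0|w0] := eqVneq w 0.
  move: uw; rewrite w0 /normalize scaler0 !subr0 => uw.
  by have := le_trans (normr_ge0 u) uw; lra.
have : `|w - normalize w| <= d.
  have -> : w - normalize w = (`|w| - 1) *: normalize w.
    by rewrite scalerBl scale1r normalizeK.
  rewrite normrZ (normalize_sphere w0 : `|_| = 1) mulr1 -(Su : `|u| = 1) distrC.
  exact: le_trans (ler_dist_dist _ _) uw.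
by have := ler_distD w u (normalize w) => *; lra.
Qed.

(** A pseudo-gradient along the compact set [A], needed only at the points of maximal
level. The weights are the amounts by which the chosen directions do better than
[- b]; a finite subcover makes their sum at least [b] at the points of maximal level,
so that the truncated quotient is a convex combination there. Averaging with
the antipode makes the field odd. *)
Lemma descent_field h (b : R) : 0 < b -> odd_sphere_map A h ->
  (forall a, A a -> Psi (h a) = J h -> exists2 v, `|v| <= 1 & G (h a) v < - (2 * b)) ->
  exists V : X -> X, [/\ {within A, continuous V}, forall a, A a -> V (- a) = - V a,
    forall a, A a -> `|V a| <= 1 &
    forall a, A a -> Psi (h a) = J h -> G (h a) (V a) <= - b].
Proof.
move=> b0 oh desc; have [ch odh sh] := oh.
have [_ hJ] := max_levelP C1 h1 cA A0 oh.
have hcvg x : A x -> h y @[y --> within A (nbhs x)] --> h x.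
  by move: ch => /subspace_continuousP; apply.
have h0 x : A x -> h x != 0 by move=> /sh/sphere_neq0.
have /choice[W WP] : forall a, exists W : X * R, A a -> [/\ `|W.1| <= 1, 0 < W.2 &
    forall y, A y -> `|a - y| < W.2 -> Psi (h y) = J h -> G (h y) W.1 < - (2 * b)].
  move=> a.
  have [Aa|nAa] := pselect (A a); last by exists (0, 0).
  have [aJ|aJ] := eqVneq (Psi (h a)) (J h).
    have [v v1 Gv] := desc a Aa aJ.
    have cG : G (h y) v @[y --> within A (nbhs a)] --> G (h a) v.
      by apply: (reduced_diff_cvg C1 h1); [exact: h0|exact: hcvg|exact: cvg_cst].
    have [d d0 dP] := within_near (cvgr_lt _ cG _ Gv).
    by exists (v, d) => _; split => // y Ay ay _; exact: dP.
  have lt_aJ : Psi (h a) < J h by rewrite lt_neqAle aJ hJ.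
  have cP : Psi (h y) @[y --> within A (nbhs a)] --> Psi (h a).
    by apply: (ray_value_cvg C1 h1); [exact: h0|exact: hcvg].
  have [d d0 dP] := within_near (cvgr_lt _ cP _ lt_aJ).
  exists (0, d) => _; split; rewrite ?normr0 // => y Ay ay yJ.
  by have := dP y Ay ay; rewrite yJ ltxx.
have : finite_subset_cover A (fun a => ball a (W a).2) A.
  move: (cA); rewrite compact_cover; apply; first by move=> a Aa; exact: ball_open.
  by move=> a Aa; exists a => //; apply: ballxx; have [] := WP a Aa.
move=> [D DA Dcov].
have DA' i : i \in enum_fset D -> A i by move=> iD; exact: set_mem (DA i iD).
pose th i y : R := Num.max 0 (- b - G (h y) (W i).1).
have th0 i y : 0 <= th i y by rewrite le_max lexx.
pose S y := \sum_(i <- enum_fset D) th i y.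
(* The truncation at b keeps the quotient continuous where all weights vanish. *)
pose M y := Num.max b (S y).
have M0 y : 0 < M y by rewrite lt_max b0.
pose V0 y := (M y)^-1 *: \sum_(i <- enum_fset D) th i y *: (W i).1.
have max_cvg (T : Type) (F : set_system T) (FF : Filter F) (c : R) (f : T -> R) (l : R) :
    f z @[z --> F] --> l -> Num.max c (f z) @[z --> F] --> Num.max c l.
  move=> fl; apply: (cvg_comp f (fun x => Num.max c x) fl).
  apply: (@lipschitz_continuous R R^o R^o _ 1) => x y; rewrite mul1r.
  rewrite /Num.max /Order.max; case: ifP => cx; case: ifP => cy; rewrite ?subrr ?normr0 //.
    by have := ler_norm (x - y); have := ler_norm (- (x - y)); rewrite normrN ler_norml => *; apply/andP; split; lra.
  by have := ler_norm (x - y); have := ler_norm (- (x - y)); rewrite normrN ler_norml => *; apply/andP; split; lra.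
have th_cvg i x : A x -> th i y @[y --> within A (nbhs x)] --> th i x.
  move=> Ax; apply: max_cvg; apply: cvgB; first exact: cvg_cst.
  by apply: (reduced_diff_cvg C1 h1); [exact: h0|exact: hcvg|exact: cvg_cst].
have V0_cvg x : A x -> V0 y @[y --> within A (nbhs x)] --> V0 x.
  move=> Ax; apply: cvgZ.
    apply: cvgV; first by rewrite gt_eqF.
    apply: max_cvg; apply: (@cvg_big R^o) => [|i _]; first exact: add_continuous.
    exact: th_cvg.
  apply: cvg_big => [|i _]; first exact: add_continuous.
  by apply: cvgZ; [exact: th_cvg|exact: cvg_cst].
have V0_1 y : `|V0 y| <= 1.
  rewrite normrZ gtr0_norm ?invr_gt0 // ler_pdivrMl // mulr1.
  apply: (@le_trans _ _ (S y)); last by rewrite le_max lexx orbT.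
  apply: le_trans (ler_norm_sum _ _ _) _; rewrite /S !big_seq; apply: ler_sum => i iD.
  by rewrite normrZ ger0_norm // ler_piMr //; have [] := WP i (DA' i iD).
have V0G y : A y -> Psi (h y) = J h -> G (h y) (V0 y) <= - b.
  move=> Ay yJ.
  have bS : b <= S y.
    have [i /= iD yi] := Dcov y Ay.
    have [_ i0] := WP i (DA' i iD); move: yi; rewrite -ball_normE /= => yi /(_ y Ay yi yJ) Gi.
    rewrite /S (big_rem i) //=; apply: (@le_trans _ _ (th i y)).
      by rewrite /th le_max; apply/orP; right; lra.
    by rewrite lerDl sumr_ge0.
  have MS : M y = S y by apply/max_idPr.
  have S0 : 0 < S y by exact: lt_le_trans bS.
  have GE : G (h y) (V0 y) = (S y)^-1 * \sum_(i <- enum_fset D) th i y * G (h y) (W i).1.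
    rewrite /V0 MS reduced_diffZ reduced_diff_sum; congr (_ * _).
    by apply: eq_bigr => i _; rewrite reduced_diffZ.
  rewrite GE ler_pdivrMl // /S mulr_suml; apply: ler_sum => i _.
  rewrite /th; have [le0|gt0] := leP (- b - G (h y) (W i).1) 0.
    by rewrite !mul0r.
  by rewrite ler_pM2l //; lra.
pose V y := (2 : R)^-1 *: (V0 y - V0 (- y)).
have AN := symmetric_setN symA.
exists V; split.
- apply/subspace_continuousP => x Ax; apply: cvgZ; first exact: cvg_cst.
  apply: cvgB; first exact: V0_cvg.
  apply: (cvg_comp (fun y => - y) V0 _ (V0_cvg _ (AN x Ax))).
  move=> P; rewrite /= /within /= => /nbhs_normP[d /= d0 dP]; apply/nbhs_normP.
  exists d => //= y xy Ay; apply: dP; last exact: AN.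
  by rewrite /= -opprD normrN.
- by move=> a _; rewrite /V opprK -[RHS]scalerN opprB.
- move=> a Aa; rewrite normrZ gtr0_norm // ler_pdivrMl // mulr1.
  have := ler_normB (V0 a) (V0 (- a)); have := V0_1 a; have := V0_1 (- a); lra.
- move=> a Aa aJ; have G1 := V0G a Aa aJ.
  have := V0G (- a) (AN a Aa); rewrite odh // (even_ray_value C1 h1 evenPhi) ?h0 // => /(_ aJ) G2.
  have := even_reduced_diff C1 h1 evenPhi (- V0 (- a)) (h0 a Aa); rewrite opprK => G3.
  rewrite G3 in G2.
  rewrite /V reduced_diffZ reduced_diffD; lra.
Qed.

(** A single step along the field, followed by normalisation, lowers the level. The
step moves points of the sphere by at most [2 * s] and lowers the level by [s * (2 * b)],
which is what the order [flow_le] requires. *)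
Lemma flow_step h (b : R) : 0 < b -> odd_sphere_map A h ->
  (forall a, A a -> Psi (h a) = J h -> exists2 v, `|v| <= 1 & G (h a) v < - (8 * b)) ->
  exists h', [/\ odd_sphere_map A h', flow_le Phi b A h' h & J h' < J h].
Proof.
move=> b0 oh desc; have [ch odh sh] := oh.
have [_ hJ] := max_levelP C1 h1 cA A0 oh.
have h0 x : A x -> h x != 0 by move=> /sh/sphere_neq0.
have b4 : 0 < 4 * b by rewrite mulr_gt0.
have [|V [cV oV V1 GV]] := descent_field b4 oh.
  by move=> a Aa /(desc a Aa)[v v1 Gv]; exists v => //; lra.
pose w (s : R) y := h y + s *: V y.
have b2 : 0 < 2 * b by rewrite mulr_gt0.
have [s s0 sP] : exists2 s : R, 0 < s & forall y, A y ->
    0 < s -> w s y != 0 /\ Psi (w s y) <= J h - s * (2 * b).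
  apply: (compact_uniform (P := fun s y => 0 < s -> w s y != 0 /\ Psi (w s y) <= J h - s * (2 * b))) => // x Ax.
  have near_hx r : 0 < r -> exists2 d : R, 0 < d & forall y, A y -> `|x - y| < d -> `|h x - h y| < r.
    by move=> r0; exact: ((within_continuousP _ _).1 ch x Ax r r0).
  have [xJ|xJ] := eqVneq (Psi (h x)) (J h).
    have Gx : G (h x) (V x) < - (2 * b) by have := GV x Ax xJ; lra.
    have [r r0 rP] := descent_near C1 h1 (h0 x Ax) Gx.
    have [d1 d10 d1P] := near_hx r r0.
    have [d2 d20 d2P] := (within_continuousP _ _).1 cV x Ax r r0.
    exists (Num.min r (Num.min d1 d2)); first by rewrite !lt_min r0 d10.
    move=> y Ay; rewrite !lt_min => /and3P[_ xy1 xy2] s /andP[s0]; rewrite !lt_min => /and3P[sr _ _] _.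
    have [|w0 Pw] := rP (h y) (V y) s (d1P y Ay xy1) (d2P y Ay xy2); first by rewrite s0.
    split => //; apply: le_trans Pw _; rewrite lerB //; exact: hJ.
  have lt_xJ : Psi (h x) < J h by rewrite lt_neqAle xJ hJ.
  pose kap := (J h - Psi (h x)) / 2.
  have kap0 : 0 < kap by rewrite divr_gt0 // subr_gt0.
  have : \forall z \near h x, z != 0 /\ Psi z < J h - kap.
    near=> z; split; near: z; first exact: neq0_near (h0 x Ax).
    apply: (cvgr_lt _ (ray_value_cvg C1 h1 (nbhs_filter (h x)) (h0 x Ax) (@cvg_id _ (nbhs (h x))))).
    by rewrite /kap; lra.
  move=> /nbhs_normP[r /= r0 rP].
  have r2 : 0 < r / 2 by rewrite divr_gt0.
  have [d d0 dP] := near_hx _ r2.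
  have kb : 0 < kap / (2 * b) by rewrite divr_gt0.
  exists (Num.min d (Num.min (r / 2) (kap / (2 * b)))); first by rewrite !lt_min d0 r2.
  move=> y Ay; rewrite !lt_min => /and3P[xy _ _] s /andP[s0]; rewrite !lt_min => /and3P[_ sr sk] _.
  have [|w0 Pw] := rP (w s y); last first.
  - by split => //; move: sk; rewrite ltr_pdivlMr // => *; lra.
  - have sV : `|s *: V y| <= s by rewrite normrZ gtr0_norm // ler_piMr ?V1 // ltW.
    rewrite /= /w opprD addrA; have := dP y Ay xy; have := ler_normB (h x - h y) (s *: V y).
    by move=> *; lra.
exists (normalize \o w s).
have wA y : A y -> w s y != 0 /\ Psi (w s y) <= J h - s * (2 * b) by move=> Ay; exact: sP.
have ow : odd_sphere_map A (normalize \o w s).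
  split.
  - apply/subspace_continuousP => x Ax; apply: normalize_cvg; first by have [] := wA x Ax.
    apply: cvgD; first by move: ch => /subspace_continuousP; apply.
    apply: cvgZ; first exact: cvg_cst.
    by move: cV => /subspace_continuousP; apply.
  - move=> a Aa /=; rewrite -normalizeN; congr normalize.
    by rewrite /w odh // oV // opprD scalerN.
  - by move=> a Aa; apply: normalize_sphere; have [] := wA a Aa.
have Jw : J (normalize \o w s) <= J h - s * (2 * b).
  have [[a Aa <-] _] := max_levelP C1 h1 cA A0 ow.
  have [w0 Pw] := wA a Aa.
  by rewrite /= (ray_value_normalize C1 h1 w0).
have sb : 0 < s * (2 * b) by rewrite mulr_gt0.
split => //; last by lra.
move=> a Aa.
have : `|h a - normalize (w s a)| <= 2 * s.
  apply: normalize_dist; first exact: sh.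
  rewrite /w opprD addrA subrr sub0r normrN normrZ gtr0_norm //.
  by rewrite ler_piMr ?V1 // ltW.
rewrite -(ler_pM2l b0) /= => *; lra.
Unshelve. all: by end_near. Qed.

(** A minimal map for [flow_le] below the inclusion of [A] moves points by at most
(d - c) / b, and by [flow_step] one of its points of maximal level is almost
critical. One step of the deformation is enough: the variational principle takes
the place of the flow of a pseudo-gradient field. *)
Theorem almost_critical_point (b c d : R) : A `<=` sphere X -> 0 < b ->
  (forall h, odd_sphere_map A h -> exists2 a, A a & c <= Psi (h a)) ->
  (forall a, A a -> Psi a <= d) ->
  exists u, [/\ sphere X u, c <= Psi u <= d,
    forall v, `|v| <= 1 -> - (8 * b) <= G u v &
    exists2 a, A a & b * `|a - u| <= d - c].
Proof.
move=> AS b0 lowc upd.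
have oid : odd_sphere_map A id.
  by split => //; apply: continuous_subspaceT => x; exact: cvg_id.
have cJ h : odd_sphere_map A h -> c <= J h.
  move=> oh; have [a Aa ca] := lowc h oh.
  by have [_ /(_ a Aa)] := max_levelP C1 h1 cA A0 oh; exact: le_trans.
have Jd : J id <= d by have [[a Aa <-] _] := max_levelP C1 h1 cA A0 oid; exact: upd.
have [h [oh hid hmin]] := flow_minimal C1 h1 cA A0 b0 cJ oid.
have [_ _ sh] := oh.
have [a Aa [aJ ncrit]] : exists2 a, A a & Psi (h a) = J h /\
    forall v, `|v| <= 1 -> - (8 * b) <= G (h a) v.
  apply: contrapT => nex.
  have [h' [oh' h'h ltJ]] : exists h', [/\ odd_sphere_map A h', flow_le Phi b A h' h & J h' < J h].
    apply: (flow_step b0 oh) => a Aa aJ; apply: contrapT => nv; apply: nex; exists a => //; split=> // v v1.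
    by rewrite leNgt; apply/negP => Gv; apply: nv; exists v.
  by have := hmin h' oh' h'h; rewrite leNgt ltJ.
have Jh := hid a Aa; have ch := cJ h oh.
exists (h a); split => //; first exact: sh.
- rewrite aJ ch /=; apply: le_trans Jd; rewrite -subr_ge0; apply: le_trans Jh.
  by rewrite mulr_ge0 // ltW.
- by exists a => //; apply: le_trans Jh _; rewrite /=; lra.
Qed.

End MinimaxPrinciple.

(** * Palais-Smale sequences *)
Lemma subsequence_cvg (T : topologicalType) (x : nat -> T) (phi : nat -> nat) (l : T) :
  {homo phi : m n / (m < n)%N} -> x n @[n --> \oo] --> l ->
  x (phi n) @[n --> \oo] --> l.
Proof.
move=> phi_lt xl P /xl[N _ NP]; exists N => // n /= Nn; apply: NP => /=.
apply: leq_trans Nn _; elim: n => [//|n IH].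
by apply: leq_ltn_trans IH _; exact: phi_lt.
Qed.

Section PalaisSmale.
Context {R : realType} {X : normedModType R} (Phi : X -> R).
Hypothesis C1 : C1_off0 Phi.
Hypothesis h1 : H1 Phi.

Local Notation t := (ray_time Phi).
Local Notation Psi := (ray_value Phi).
Local Notation G := (reduced_diff Phi).

(** Almost critical points of the reduced functional lie on rays that meet the Nehari
set in a Palais-Smale sequence of [Phi]; the lower bound on [t] controls the
quotient of the two derivatives. *)
Lemma palais_smale_sphere (u : nat -> X) (e : nat -> R) (c : R) :
  palais_smale_nehari Phi -> (forall n, sphere X (u n)) ->
  Psi (u n) @[n --> \oo] --> c -> e n @[n --> \oo] --> (0 : R) ->
  (forall n v, `|v| <= 1 -> - e n <= G (u n) v) ->
  exists (phi : nat -> nat) (p : X), [/\ {homo phi : m n / (m < n)%N}, sphere X p, u (phi n) @[n --> \oo] --> p,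
    Psi p = c & critical_points Phi (t p *: p)].
Proof.
move=> PS Su Pc ecvg Ge; have u0 n := sphere_neq0 (Su n).
have t0 n := ray_time_gt0 C1 h1 (u0 n).
have Gabs n v : `|v| <= 1 -> `|G (u n) v| <= e n.
  move=> v1; have := Ge n v v1; have := Ge n (- v); rewrite normrN => /(_ v1).
  rewrite -[- v]scaleN1r reduced_diffZ mulN1r ler_norml => *; apply/andP; split; lra.
case: (h1) => _ [d d0 dt] _.
pose w n := t (u n) *: u n.
have [|||phi [l [phi_lt l0 wl]]] := PS w.
- by move=> n; exact: (nehari_ray C1 h1 (u0 n)).
- have [M [_ Mb]] := cvg_seq_bounded (cvgP _ Pc).
  by exists (M + 1) => n; apply: Mb => //; rewrite ltrDl.
- have dn n : (dual_norm ('d Phi (w n)) <= (e n / d)%:E)%E.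
    apply: dual_norm_le => v v1; rewrite ler_pdivlMr //.
    apply: le_trans (Gabs n v v1); rewrite normrM mulrC (gtr0_norm (t0 n)).
    by rewrite ler_wpM2r // dt.
  apply: (@squeeze_cvge _ _ _ _ (fun=> 0%E) _ (fun n => (e n / d)%:E)).
  + by exists 0%N => // n _; rewrite dual_norm_ge0 dn.
  + exact: cvg_cst.
  + apply: cvg_EFin; first by exists 0%N.
    by rewrite -(mul0r d^-1); apply: cvgM => //; exact: cvg_cst.
have nw n : normalize (w n) = u n.
  rewrite /normalize /w normrZ (Su n : `|_| = 1) mulr1 gtr0_norm //.
  by rewrite scalerA mulVf ?scale1r // gt_eqF.
exists phi, (normalize l).
have Sp := normalize_sphere l0; have p0 := sphere_neq0 Sp.
have up : u (phi n) @[n --> \oo] --> normalize l.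
  under eq_fun do rewrite -nw.
  exact: normalize_cvg.
split => //.
  have P1 : Psi (u (phi n)) @[n --> \oo] --> Psi (normalize l).
    exact: (ray_value_cvg C1 h1 _ p0 up).
  exact: (cvg_unique _ P1 (subsequence_cvg phi_lt Pc)).
have G0 v : `|v| <= 1 -> G (normalize l) v = 0.
  move=> v1; apply/eqP; rewrite -normr_le0.
  have cG : `|G (u (phi n)) v| @[n --> \oo] --> `|G (normalize l) v|.
    apply: cvg_norm; exact: (reduced_diff_cvg C1 h1 _ p0 up (cvg_cst _)).
  apply: (ler_cvg_to cG (subsequence_cvg phi_lt ecvg)).
  by exists 0%N => // n _; exact: Gabs.
apply: (reduced_diff_eq0 C1 h1 p0) => v.
have [->|v0] := eqVneq v 0; first by apply: G0; rewrite normr0.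
rewrite -(normalizeK v0) reduced_diffZ G0 ?mulr0 //.
by rewrite (normalize_sphere v0 : `|_| = 1).
Qed.

End PalaisSmale.

(** * The genus *)
Section Genus.
Context {R : realType} {X : normedModType R}.
Implicit Types (F A : set X) (n k : nat).

Lemma genus_geP F n :
  ((n%:R : R)%:E <= genus F)%E <-> forall k, odd_map_to_punctured F k -> (n <= k)%N.
Proof.
split=> [nF k Fk|nF].
  have : (genus F <= (k%:R : R)%:E)%E by apply: ereal_inf_lbound; exists k.
  by move=> /(le_trans nF); rewrite lee_fin ler_nat.
by apply: le_ereal_inf_tmp => _ [k Fk <-]; rewrite lee_fin ler_nat; exact: nF.
Qed.

Lemma genus_family_neq0 F n : (0 < n)%N -> genus_family X n F -> F !=set0.
Proof.
move=> n0 [_ _ _ /genus_geP nF]; apply/set0P; apply: contraTneq n0 => F0.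
rewrite lt0n negbK -leqn0; apply: nF; rewrite F0; exists (fun=> 0); split=> //.
by apply: continuous_subspaceT => x; exact: cvg_cst.
Qed.

Lemma genus_family_mono F m n : (m <= n)%N -> genus_family X n F -> genus_family X m F.
Proof.
move=> mn [cF sF SF nF]; split => //; apply: le_trans nF.
by rewrite lee_fin ler_nat.
Qed.

Lemma genus_family_image F n (h : X -> X) : odd_sphere_map F h -> genus_family X n F ->
  genus_family X n (h @` F).
Proof.
move=> [ch oh sh] [cF sF SF /genus_geP nF]; split.
- exact: continuous_compact.
- apply/seteqP; split=> [_ [_ [a Fa <-] <-]|_ [a Fa <-]].
    by exists (- a); [exact: symmetric_setN|exact: oh].
  exists (h (- a)); first by exists (- a) => //; exact: symmetric_setN.
  by rewrite oh // opprK.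
- by move=> _ [a Fa <-]; exact: sh.
- apply/genus_geP => k [f [cf of_ nf]]; apply: nF; exists (f \o h); split.
  + apply/within_continuousP => x Fx e e0.
    have [d d0 dP] := (within_continuousP _ _).1 cf _ (imageP h Fx) e e0.
    have [d' d'0 d'P] := (within_continuousP _ _).1 ch x Fx d d0.
    exists d' => // y Fy xy; apply: dP; first exact: imageP.
    exact: d'P.
  + by move=> u Fu /=; rewrite oh // of_ //; exact: imageP.
  + by move=> u Fu /=; apply: nf; exact: imageP.
Qed.

(** The sphere of an n-dimensional subspace, parametrised by the unit sphere of the sum
norm on the coordinates; the Borsuk-Ulam theorem bounds its genus from below. *)
Lemma genus_family_exists n : infinite_dimensional X -> exists F, genus_family X n F.
Proof.
move=> /(_ n)[e e_free].
pose L (a : 'rV[R]_n) := \sum_(i < n) a 0 i *: e i.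
have LN a : L (- a) = - L a.
  by rewrite /L -sumrN; apply: eq_bigr => i _; rewrite mxE scaleNr.
have L0 a : l1_sphere a -> L a != 0.
  move=> Sa; apply/eqP => /e_free a0; move: Sa; rewrite /l1_sphere /= big1; last first.
    by move=> i _; rewrite a0 normr0.
  by move=> /esym/eqP; rewrite oner_eq0.
have cL : continuous L.
  apply: (@lipschitz_continuous R _ _ _ (\sum_(i < n) `|e i|)) => a b.
  rewrite -sumrB mulr_suml; apply: le_trans (ler_norm_sum _ _ _) _.
  apply: ler_sum => i _; rewrite -scalerBl normrZ mulrC ler_wpM2l //.
  by have <- : (a - b) 0 i = a 0 i - b 0 i; [rewrite !mxE|exact: coord_le_norm].
pose N := normalize \o L.
have cN : {within @l1_sphere R n, continuous N}.
  apply/subspace_continuousP => x Sx; apply: normalize_cvg; first exact: L0.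
  by apply: cvg_within_filter; exact: cL.
have SN (a : 'rV[R]_n) : l1_sphere a -> l1_sphere (- a).
  by rewrite /l1_sphere /= => <-; apply: eq_bigr => i _; rewrite mxE normrN.
exists (N @` @l1_sphere R n); split.
- exact: continuous_compact cN (@l1_sphere_compact R n).
- apply/seteqP; split=> [_ [_ [a Sa <-] <-]|_ [a Sa <-]].
    by exists (- a); [exact: SN|rewrite /N /= LN normalizeN].
  exists (N (- a)); first by exists (- a) => //; exact: SN.
  by rewrite /N /= LN normalizeN opprK.
- by move=> _ [a Sa <-]; apply: normalize_sphere; exact: L0.
- apply/genus_geP => k [f [cf of_ nf]]; apply: (@borsuk_ulam R n k (f \o N)).
  + apply/within_continuousP => x Sx d d0.
    have [r r0 rP] := (within_continuousP _ _).1 cf _ (imageP N Sx) d d0.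
    have [r' r'0 r'P] := (within_continuousP _ _).1 cN x Sx r r0.
    exists r' => // y Sy xy; apply: rP; first exact: imageP.
    exact: r'P.
  + by move=> x Sx /=; rewrite /N /= LN normalizeN of_ //; exact: (imageP N Sx).
  + by move=> x Sx /=; apply: nf; exact: imageP.
Qed.

(** Tietze's extension followed by taking the odd part. *)
Lemma odd_extension A (f : X -> R) : compact A -> symmetric_set A ->
  {within A, continuous f} -> (forall a, A a -> f (- a) = - f a) ->
  exists g : X -> R, [/\ continuous g, forall x, g (- x) = - g x &
    forall a, A a -> g a = f a].
Proof.
move=> cA sA cf of_.
have clA : closed A by apply: compact_closed cA; exact: norm_hausdorff.
have [M M0 fM] : exists2 M : R, 0 < M & forall x, A x -> `|f x| <= M.
  have [M [_ Mb]] := compact_bounded (continuous_compact cf cA).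
  exists (`|M| + 1); first by rewrite ltr_wpDl.
  by move=> x Ax; apply: (Mb (`|M| + 1)); [rewrite ltr_pwDr // ler_norm|exists x].
have [g [fg cg _]] := continuous_bounded_extension (@pseudometric_normal R X) clA M0 cf fM.
exists (fun x => (g x - g (- x)) / 2); split.
- move=> x; apply: cvgM; last exact: cvg_cst.
  apply: cvgB; first exact: cg.
  apply: (cvg_comp (fun y => - y) g _ (cg (- x))); exact: cvgN cvg_id.
- by move=> x; rewrite opprK; lra.
- move=> a Aa; rewrite -!fg ?in_setE //; last exact: symmetric_setN.
  by rewrite of_ //; lra.
Qed.

Lemma rV_within_continuous k A (f : X -> 'rV[R]_k) :
  (forall i, {within A, continuous (fun x => f x 0 i)}) -> {within A, continuous f}.
Proof.
move=> cf; apply/subspace_continuousP => x Ax; apply/cvgrPdist_lt => e e0.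
have : \forall y \near within A (nbhs x), forall i, `|f x 0 i - f y 0 i| < e.
  apply: filter_forall => i; move: (cf i) => /subspace_continuousP/(_ x Ax).
  by move=> /cvgrPdist_lt/(_ e e0).
apply: filterS => y fxy.
rewrite -[ltLHS]/(mx_norm (f x - f y)) mx_normrE; apply: bigmax_lt => //= -[i j] _ /=.
by rewrite !mxE ord1.
Qed.

(** An odd map that does not vanish on the zeros of [psi], extended and completed by the
coordinate [psi], does not vanish on the whole set. *)
Lemma genus_family_zeros F n (psi : X -> R) : continuous psi ->
  (forall x, psi (- x) = - psi x) -> genus_family X n.+1 F ->
  genus_family X n (F `&` [set x | psi x = 0]).
Proof.
move=> cpsi opsi [cF sF SF /genus_geP nF].
set A := _ `&` _.
have sA : symmetric_set A.
  apply/seteqP; split=> [_ [a [Fa a0] <-]|a [Fa a0]].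
    by split; [exact: symmetric_setN|rewrite /= opsi a0 oppr0].
  exists (- a); last exact: opprK.
  by split; [exact: symmetric_setN|rewrite /= opsi a0 oppr0].
have cA : compact A.
  apply: compact_closedI => //.
  by apply: (@preimage_closed _ _ psi [set r | r = 0]); [move=> x _; exact: cpsi|exact: closed_eq].
split => //; first by move=> x [/SF].
apply/genus_geP => k [f [cf of_ nf]].
have /choice[g gP] : forall i : 'I_k, exists g : X -> R, [/\ continuous g,
    forall x, g (- x) = - g x & forall a, A a -> g a = f a 0 i].
  move=> i; apply: (odd_extension cA sA); last by move=> a Aa; rewrite of_ // mxE.
  apply/within_continuousP => x Ax e e0.
  have [d d0 dP] := (within_continuousP _ _).1 cf x Ax e e0.
  exists d => // y Ay xy; apply: le_lt_trans (dP y Ay xy).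
  by have <- : (f x - f y) 0 i = f x 0 i - f y 0 i; [rewrite !mxE|exact: coord_le_norm].
rewrite -ltnS; apply: nF.
pose h j x : R := if unlift (@ord_max k) j is Some i then g i x else psi x.
exists (fun x => \row_j h j x); split.
- apply: rV_within_continuous => j; apply: continuous_subspaceT => x.
  under eq_fun do rewrite mxE.
  rewrite /h; case: (unlift _ j) => [i|]; last exact: cpsi.
  by have [cg _ _] := gP i; exact: cg.
- move=> u _; apply/rowP => j; rewrite !mxE /h; case: (unlift _ j) => [i|] //.
  by have [_ og _] := gP i; exact: og.
- move=> u Fu; apply/eqP => /rowP h0.
  have psi0 : psi u = 0 by have := h0 ord_max; rewrite !mxE /h unlift_none.
  have Au : A u by split.
  have /eqP := nf u Au; apply; apply/rowP => i; rewrite !mxE.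
  have := h0 (lift ord_max i); rewrite !mxE /h liftK.
  by have [_ _ ->] := gP i.
Qed.

End Genus.

(** * The minimax levels are critical *)
(** Add to a function that is good for the tail a small multiple of the difference of the
distances to [- p] and [p], which does not vanish at [p]. *)
Lemma odd_nonvanishing (R : realType) (X : normedModType R) (s : seq X) :
  (forall x, x \in s -> x != 0) ->
  exists psi : X -> R, [/\ continuous psi, forall x, psi (- x) = - psi x &
    forall x, x \in s -> psi x != 0].
Proof.
elim: s => [_|p s IH s0].
  exists (fun=> 0); split => // [x|x]; first exact: cvg_cst.
  by rewrite oppr0.
have [x xs|psi [cpsi opsi psi0]] := IH; first by apply: s0; rewrite inE xs orbT.
have p0 : p != 0 by apply: s0; rewrite mem_head.
have [pp|pp] := eqVneq (psi p) 0; last first.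
  by exists psi; split => // x; rewrite inE => /orP[/eqP ->|/psi0].
pose phi x : R := `|x + p| - `|x - p|.
have cphi : continuous phi.
  move=> x; apply: cvgB; apply: cvg_norm; first by apply: cvgD; [exact: cvg_id|exact: cvg_cst].
  by apply: cvgB; [exact: cvg_id|exact: cvg_cst].
have ophi x : phi (- x) = - phi x.
  rewrite /phi -[- x - p]opprD normrN.
  have -> : - x + p = - (x - p) by rewrite opprB addrC.
  by rewrite normrN opprB.
have phip : 0 < phi p.
  have pE : p + p = (2 : R) *: p by rewrite scaler_nat mulr2n.
  by rewrite /phi subrr normr0 subr0 normr_gt0 pE scaler_eq0 negb_or p0 pnatr_eq0.
have [e e0 eP] : exists2 e : R, 0 < e & forall x, x \in s -> `|e * phi x| < `|psi x|.
  elim: (s) psi0 => [|y s' IH' psi0]; first by exists 1.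
  have [x xs|e e0 eP] := IH'; first by apply: psi0; rewrite inE xs orbT.
  have y0 : 0 < `|psi y| by rewrite normr_gt0 psi0 // mem_head.
  have d0 : 0 < `|psi y| / (`|phi y| + 1) by rewrite divr_gt0 // ltr_wpDl.
  exists (Num.min e (`|psi y| / (`|phi y| + 1))); first by rewrite lt_min e0.
  move=> x; rewrite inE normrM gtr0_norm ?lt_min ?e0 // => /orP[/eqP ->|xs].
    apply: (@le_lt_trans _ _ (`|psi y| / (`|phi y| + 1) * `|phi y|)).
      by rewrite ler_wpM2r // ge_min lexx orbT.
    by rewrite mulrAC ltr_pdivrMr ?ltr_wpDl // ltr_pM2l // ltrDl.
  apply: le_lt_trans (eP x xs); rewrite normrM (gtr0_norm e0) ler_wpM2r //.
  by rewrite ge_min lexx.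
exists (fun x => psi x + e * phi x); split.
- by move=> x; apply: cvgD; [exact: cpsi|apply: cvgM; [exact: cvg_cst|exact: cphi]].
- by move=> x; rewrite opsi ophi mulrN opprD.
- move=> x; rewrite inE => /orP[/eqP ->|xs].
    by rewrite pp add0r mulf_neq0 ?gt_eqF.
  apply: contraTneq (eP x xs) => /eqP; rewrite addr_eq0 => /eqP ->.
  by rewrite normrN ltxx.
Qed.

Section MinimaxLevels.
Context {R : realType} {X : completeNormedModType R} (Phi : X -> R).
Hypothesis C1 : C1_off0 Phi.
Hypothesis h1 : H1 Phi.
Implicit Types (F : set X) (n k : nat).

Local Notation t := (ray_time Phi).
Local Notation Psi := (ray_value Phi).

Lemma lambda_mono m n : (m <= n)%N -> (lambda Phi m <= lambda Phi n)%E.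
Proof.
move=> mn; apply: ereal_inf_le_tmp => _ [F Fn <-]; exists F => //.
exact: genus_family_mono Fn.
Qed.

Lemma ereal_sup_level F n : (0 < n)%N -> genus_family X n F ->
  ereal_sup [set (Psi u)%:E | u in F] = (max_level Phi F id)%:E.
Proof.
move=> n0 Fn; have F0 := genus_family_neq0 n0 Fn; have [cF sF SF _] := Fn.
have oid : odd_sphere_map F id.
  by split => //; apply: continuous_subspaceT => x; exact: cvg_id.
have [[a Fa aJ] ub] := max_levelP C1 h1 cF F0 oid.
apply/eqP; rewrite eq_le; apply/andP; split.
  by apply: ge_ereal_sup => _ [u Fu <-]; rewrite lee_fin ub.
by apply: ereal_sup_ubound; exists a => //; rewrite -aJ.
Qed.

Lemma lambda_ge (c : R) n : (0 < n)%N ->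
  (forall F, genus_family X n F -> exists2 a, F a & c <= Psi a) ->
  (c%:E <= lambda Phi n)%E.
Proof.
move=> n0 Fc; apply: le_ereal_inf_tmp => _ [F Fn <-].
have [a Fa ca] := Fc F Fn; apply: (@le_trans _ _ (Psi a)%:E); first by rewrite lee_fin.
by apply: ereal_sup_ubound; exists a.
Qed.

Lemma lambda_fin n : infinite_dimensional X ->
  (exists m : R, forall u, nehari Phi u -> m <= Phi u) -> (0 < n)%N ->
  exists c : R, [/\ lambda Phi n = c%:E,
    forall F, genus_family X n F -> exists2 a, F a & c <= Psi a &
    forall e : R, 0 < e -> exists2 F, genus_family X n F & forall a, F a -> Psi a <= c + e].
Proof.
move=> Xinf [m mP] n0.
have [F Fn] := genus_family_exists n Xinf.
have lamF F' : genus_family X n F' -> (lambda Phi n <= (max_level Phi F' id)%:E)%E.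
  by move=> F'n; apply: ereal_inf_lbound; exists F' => //; exact: ereal_sup_level F'n.
have mlam : (m%:E <= lambda Phi n)%E.
  apply: lambda_ge => // F' F'n; have [a F'a] := genus_family_neq0 n0 F'n.
  exists a => //; have [_ _ SF' _] := F'n.
  by apply: mP; exact: (nehari_ray C1 h1 (sphere_neq0 (SF' _ F'a))).
have fin : lambda Phi n \is a fin_num.
  by rewrite fin_numE; apply/andP; split; apply/eqP => lE; move: mlam (lamF F Fn); rewrite lE.
exists (fine (lambda Phi n)); rewrite fineK //; split => //.
  move=> F' F'n; have F'0 := genus_family_neq0 n0 F'n; have [cF sF SF _] := F'n.
  have oid : odd_sphere_map F' id.
    by split => //; apply: continuous_subspaceT => x; exact: cvg_id.
  have [[a Fa aJ] _] := max_levelP C1 h1 cF F'0 oid.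
  by exists a => //; rewrite -lee_fin fineK // [Psi a]aJ lamF.
move=> e e0; have [_ [F' F'n <-]] := lb_ereal_inf_adherent e0 fin.
rewrite -/(lambda Phi n) => lt_e; exists F' => // a F'a.
rewrite -lee_fin EFinD fineK //; apply: le_trans (ltW lt_e).
by apply: ereal_sup_ubound; exists a.
Qed.

(** With the excess e ^ 2 over the level and the price e, the almost critical points of
[almost_critical_point] stay within e of the closed set [Q] that contains the
competing sets, so their limit belongs to [Q]. *)
Lemma minimax_critical n (c : R) (Q : set X) : even_off0 Phi -> palais_smale_nehari Phi ->
  (0 < n)%N -> closed Q ->
  (forall F, genus_family X n F -> exists2 a, F a & c <= Psi a) ->
  (forall e : R, 0 < e -> exists F, [/\ genus_family X n F, F `<=` Q &
     forall a, F a -> Psi a <= c + e]) ->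
  exists p, [/\ sphere X p, Q p, Psi p = c & critical_points Phi (t p *: p)].
Proof.
move=> ev PS n0 clQ lowc uppc.
pose e m : R := m.+1%:R^-1.
have e0 m : 0 < e m by rewrite invr_gt0.
have ecvg : e m @[m --> \oo] --> (0 : R) by exact: cvg_harmonic.
have /choice[ua uaP] : forall m, exists ua : X * X, [/\ sphere X ua.1, Q ua.2,
    c <= Psi ua.1 <= c + e m * e m,
    forall v, `|v| <= 1 -> - (8 * e m) <= reduced_diff Phi ua.1 v & `|ua.2 - ua.1| <= e m].
  move=> m; have ee0 : 0 < e m * e m by rewrite mulr_gt0.
  have [F [Fn FQ Fc]] := uppc _ ee0; have [cF sF SF _] := Fn.
  have [|u [Su uc Gu [a Fa au]]] :=
      almost_critical_point C1 h1 ev cF (genus_family_neq0 n0 Fn) sF SF (e0 m) _ Fc (c := c).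
    move=> h oh; have [_ [a Fa <-] ca] := lowc _ (genus_family_image oh Fn).
    by exists a.
  exists (u, a); split => //=; first exact: FQ.
  by rewrite -(ler_pM2l (e0 m)); apply: le_trans au _; rewrite addrAC subrr add0r.
pose u m := (ua m).1; pose a m := (ua m).2.
have Pc : Psi (u m) @[m --> \oo] --> c.
  apply: (@squeeze_cvgr _ _ _ _ (fun=> c) (fun m => c + e m * e m)).
  - by exists 0%N => // m _; have [_ _] := uaP m.
  - exact: cvg_cst.
  - rewrite -[X in _ --> X]addr0 -[X in _ + X](mulr0 0).
    by apply: cvgD; [exact: cvg_cst|exact: cvgM].
have [||||phi [p [phi_lt Sp up pc crit]]] := @palais_smale_sphere _ _ _ C1 h1 u (fun m => 8 * e m) c PS.
- by move=> m; have [] := uaP m.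
- exact: Pc.
- by rewrite -(mulr0 8); apply: cvgM => //; exact: cvg_cst.
- by move=> m; have [_ _ _] := uaP m.
exists p; split => //.
apply: (@closed_cvg _ _ (\oo : set_system nat) _ (fun m => a (phi m)) Q clQ).
  by exists 0%N => // m _; have [] := uaP (phi m).
have au : a m - u m @[m --> \oo] --> (0 : X).
  apply/cvgrPdist_lt => d d0; have /cvgrPdist_lt/(_ d d0) := ecvg.
  apply: filterS => m; rewrite !sub0r !normrN gtr0_norm //.
  by apply: le_lt_trans; have [] := uaP m.
have -> : (fun m => a (phi m)) = (fun m => (a (phi m) - u (phi m)) + u (phi m)).
  by apply/funext => m; rewrite subrK.
rewrite -[p]add0r; apply: cvgD => //; exact: (subsequence_cvg phi_lt au).
Qed.

Lemma lambda_critical n : infinite_dimensional X -> H2 Phi -> (0 < n)%N ->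
  exists2 c : R, lambda Phi n = c%:E & critical_values Phi c.
Proof.
move=> Xinf [ev bdd PS] n0; have [c [lc lowc uppc]] := lambda_fin Xinf bdd n0.
have [|p [Sp _ pc crit]] := minimax_critical ev PS n0 closedT lowc.
  by move=> e e0; have [F Fn Fc] := uppc e e0; exists F.
by exists c => //; exists (t p *: p).
Qed.

(** Choose an odd function [psi] that does not vanish on the directions of the points of
[s]. The zeros of [psi] in a set of genus n + 1 have genus at least n, so they
compete for the level n, which is the same level; the critical point obtained has
its direction among the zeros of [psi] and is therefore not in [s]. *)
Lemma lambda_eq_critical n (s : seq X) : infinite_dimensional X -> H2 Phi -> (0 < n)%N ->
  lambda Phi n = lambda Phi n.+1 -> (forall x, x \in s -> x != 0) ->
  exists2 w, critical_points Phi w & w \notin s.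
Proof.
move=> Xinf [ev bdd PS] n0 lam_eq s0; have [c [lc lowc _]] := lambda_fin Xinf bdd n0.
have [c' [lc' _ uppc]] := lambda_fin Xinf bdd (ltn0Sn n).
have cc' : c = c' by move: lam_eq; rewrite lc lc' => -[].
rewrite -{c'}cc' in lc' uppc.
have ns0 x : x \in map normalize s -> x != 0.
  by move=> /mapP[y ys ->]; apply/sphere_neq0/normalize_sphere/s0.
have [psi [cpsi opsi psi0]] := odd_nonvanishing ns0.
have clQ : closed [set x | psi x = 0].
  by apply: (@preimage_closed _ _ psi [set r | r = 0]); [move=> x _; exact: cpsi|exact: closed_eq].
have [|p [Sp Qp pc crit]] := minimax_critical ev PS n0 clQ lowc.
  move=> e e0; have [F Fn Fc] := uppc e e0.
  exists (F `&` [set x | psi x = 0]); split; first exact: genus_family_zeros.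
    by move=> x [].
  by move=> a [/Fc].
exists (t p *: p) => //; apply/negP => ws.
have p0 := sphere_neq0 Sp; have t0 := ray_time_gt0 C1 h1 p0.
have np : normalize (t p *: p) = p.
  rewrite /normalize normrZ (Sp : `|_| = 1) mulr1 gtr0_norm // scalerA.
  by rewrite mulVf ?scale1r // gt_eqF.
have := psi0 p; rewrite -[p in p \in _]np map_f // => /(_ isT).
by rewrite [psi p]Qp eqxx.
Qed.

End MinimaxLevels.

(** * Weakly null sequences in uniformly convex spaces *)
(** The derivative of the norm at [d] is a functional of norm 1 that attains its norm
at [d]; it stands in for the Hahn-Banach theorem. *)
Section NormDerivative.
Context {R : realType} {X : normedModType R}.
Hypothesis norm_C1 : C1_off0 (fun u : X => `|u|).
Implicit Types d v : X.

Local Notation nu d := ('d (fun u : X => `|u|) d).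

Lemma norm_diff_le d v : d != 0 -> `|nu d v| <= `|v|.
Proof.
move=> d0; have [dd _] := norm_C1 d0.
rewrite -(deriveE v dd); apply: (cvgr_to_le (cvg_norm (diff_derivable (v := v) dd))).
near=> h; rewrite normrM normfV.
have h0 : h != 0 by near: h; exact: nbhs_dnbhs_neq.
rewrite ler_pdivrMl ?normr_gt0 // -normrZ /=.
by apply: le_trans (ler_dist_dist _ _) _; rewrite addrK.
Unshelve. all: by end_near. Qed.

Lemma norm_diff_self d : d != 0 -> nu d d = `|d|.
Proof.
move=> d0; have [dd _] := norm_C1 d0; rewrite -(deriveE d dd).
have quot : \forall h \near (0 : R)^', h^-1 * (`|h *: d + d| - `|d|) = `|d|.
  near=> h; have h0 : h != 0 by near: h; exact: nbhs_dnbhs_neq.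
  have h1 : `|h| < 1 by near: h; apply: dnbhs0_lt.
  have -> : h *: d + d = (h + 1) *: d by rewrite scalerDl scale1r.
  rewrite normrZ ger0_norm; last first.
    by move: h1; rewrite ltr_norml => /andP[? _]; lra.
  by rewrite mulrDl mul1r addrK mulKf.
apply/eqP; rewrite eq_le; apply/andP; split.
  apply: (cvgr_to_le (diff_derivable (v := d) dd)).
  by apply: filterS quot => h /= qh; rewrite -[leRHS]qh.
apply: (cvgr_to_ge (diff_derivable (v := d) dd)).
by apply: filterS quot => h /= qh; rewrite -[leLHS]qh.
Unshelve. all: by end_near. Qed.

End NormDerivative.

Section WeaklyNullSequence.
Context {R : realType} {X : completeNormedModType R}.
Hypothesis uconvex : uniformly_convex X.
Hypothesis norm_C1 : C1_off0 (fun u : X => `|u|).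
Implicit Types (S : set X) (K : nat -> set X) (d x y : X).

Local Notation nu d := ('d (fun u : X => `|u|) d).

Definition midpoint x y : X := (2 : R)^-1 *: (x + y).

(** Almost minimal points of nested midpoint-convex sets have midpoints of almost maximal
norm, so by uniform convexity their directions form a Cauchy sequence. *)
Lemma uniformly_convex_nested K (k : R) : 0 < k ->
  (forall m n, (m <= n)%N -> K n `<=` K m) ->
  (forall m x y, K m x -> K m y -> K m (midpoint x y)) ->
  (forall m, K m !=set0) ->
  (forall m x, K m x -> k <= `|x| <= 1) ->
  exists y : nat -> X, (forall m, K m (y m)) /\ cvg (normalize (y m) @[m --> \oo]).
Proof.
move=> k0 Kdec Kmid K0 Kb.
pose E m := [set `|x| | x in K m].
have lbE m : has_lbound (E m) by exists k => _ [x Kx <-]; have /andP[] := Kb m x Kx.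
have infE m : has_inf (E m).
  by split => //; have [x Kx] := K0 m; exists `|x|, x.
pose r m := inf (E m).
have rle m x : K m x -> r m <= `|x| by move=> Kx; apply: ge_inf => //; exists x.
have /choice[y yP] : forall m, exists y, K m y /\ `|y| <= r m + m.+1%:R^-1.
  move=> m; have m0 : 0 < m.+1%:R^-1 :> R by rewrite invr_gt0.
  by have [_ [x Kx <-] /ltW xr] := inf_adherent m0 (infE m); exists x.
exists y; split; first by move=> m; have [] := yP m.
have rdec : nondecreasing_seq r.
  move=> m n mn; apply: lb_le_inf; first by have [x Kx] := K0 n; exists `|x|, x.
  by move=> _ [x Kx <-]; apply: rle; exact: Kdec Kx.
have ub : has_ubound (range r).
  exists 1 => _ [m _ <-]; have [x Kx] := K0 m; apply: le_trans (rle m x Kx) _.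
  by have /andP[] := Kb m x Kx.
have rcvg := nondecreasing_cvgn rdec ub.
set L := sup _ in rcvg.
have rL m : r m <= L by apply: ub_le_sup => //; exists m.
have kL : k <= L.
  apply: le_trans (rL 0%N); apply: lb_le_inf; first by have [x Kx] := K0 0%N; exists `|x|, x.
  by move=> _ [x Kx <-]; have /andP[] := Kb 0%N x Kx.
have L0 : 0 < L by exact: lt_le_trans kL.
apply: cauchy_seq_cvg => eps eps0.
have [del del0 delP] := uconvex eps0.
have [th th0 thE] : exists2 th : R, 0 < th & 4 * th = del * L.
  exists (del * L / 4); first by rewrite divr_gt0 ?mulr_gt0.
  by rewrite mulrC divfK.
have /cvgrPdist_lt/(_ th th0) rcvg_th := rcvg.
have : \forall N \near \oo, `|L - r N| < th /\ (N.+1%:R^-1 : R) < th.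
  near=> N; split; near: N; last exact: near_infty_natSinv_lt (PosNum th0).
  exact: rcvg_th.
move=> [N _ /(_ N (leqnn N))[LrN Nth]]; exists N => n Nn.
rewrite ltNge; apply/negP => zz.
have yn0 m : y m != 0.
  have [Ky _] := yP m; rewrite -normr_gt0; have /andP[+ _] := Kb m _ Ky; exact: lt_le_trans.
have := delP _ _ (normalize_sphere (yn0 N)) (normalize_sphere (yn0 n)) zz.
apply/negP; rewrite -ltNge.
have rNL : L - th < r N by move: LrN; rewrite ltr_norml => /andP[_]; lra.
have znear m : (N <= m)%N -> L * `|normalize (y m) - L^-1 *: y m| <= th.
  move=> Nm; have -> : normalize (y m) - L^-1 *: y m = (L^-1 * (L - `|y m|)) *: normalize (y m).
    rewrite -{2}(normalizeK (yn0 m)) scalerA -[X in X - _]scale1r -scalerBl.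
    by congr (_ *: _); rewrite mulrBr mulVf // gt_eqF.
  rewrite normrZ (normalize_sphere (yn0 m) : `|_| = 1) mulr1 normrM gtr0_norm ?invr_gt0 //.
  rewrite mulrA mulfV ?gt_eqF // mul1r.
  have [Ky yr] := yP m.
  have ry : r m <= `|y m| := rle m _ Ky.
  have rNm : r N <= r m := rdec _ _ Nm.
  have rmL : r m <= L := rL m.
  have inv : m.+1%:R^-1 <= N.+1%:R^-1 :> R by rewrite lef_pV2 ?posrE // ler_nat.
  move: yr inv Nth; move: (m.+1%:R^-1 : R) (N.+1%:R^-1 : R) => a b yr inv Nth.
  by rewrite ler_norml; apply/andP; split; lra.
have mid : r N <= `|midpoint (y N) (y n)|.
  apply: rle; apply: Kmid; first by have [] := yP N.
  by apply: (Kdec _ _ Nn); have [] := yP n.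
have Lmid : L * `|L^-1 *: midpoint (y N) (y n)| = `|midpoint (y N) (y n)|.
  by rewrite normrZ gtr0_norm ?invr_gt0 // mulrA mulfV ?gt_eqF // mul1r.
set z := 2^-1 *: _.
have zE : L^-1 *: midpoint (y N) (y n) =
    z - 2^-1 *: ((normalize (y N) - L^-1 *: y N) + (normalize (y n) - L^-1 *: y n)).
  rewrite /z -scalerBr /midpoint !scalerA mulrC -scalerA scalerDr; congr (_ *: _).
  by rewrite opprD !opprB addrACA !subrKC.
rewrite -(ltr_pM2l L0).
have := znear N (leqnn N); have := znear n Nn.
have : `|midpoint (y N) (y n)| <= L * `|z| + 2^-1 * (L * `|normalize (y N) - L^-1 *: y N| + L * `|normalize (y n) - L^-1 *: y n|).
  rewrite -Lmid zE; set A := normalize _ - _; set B := normalize _ - _.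
  have : `|z - 2^-1 *: (A + B)| <= `|z| + 2^-1 * (`|A| + `|B|).
    apply: le_trans (ler_normB _ _) _; rewrite lerD2l normrZ gtr0_norm ?invr_gt0 //.
    by rewrite ler_wpM2l ?invr_ge0 // ler_normD.
  by rewrite -(ler_pM2l L0) => *; lra.
move=> *; lra.
Unshelve. all: by end_near. Qed.

(** Midpoints suffice in place of all convex combinations, and they are generated in
countably many steps from a sequence. *)
Inductive midpoint_hull S : X -> Prop :=
| midpoint_hull_base x : S x -> midpoint_hull S x
| midpoint_hull_mid x y : midpoint_hull S x -> midpoint_hull S y ->
    midpoint_hull S (midpoint x y).

(** Choose [u n] in [B] annihilated by the derivatives of the norm at the finitely many
midpoint combinations of earlier terms formed so far. If a functional [f] stayed
away from 0 along a subsequence, the midpoint hulls of its tails would stay away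
from the origin, and the directions of their almost minimal points [y m] would converge
to some [l]. The derivative of the norm at [y m] annihilates late terms, hence [l],
but takes the value 1 at the direction of [y m], whose distance to [l] is therefore
at least 1. *)
Lemma weakly_null_sequence (B : set X) : B `<=` sphere X ->
  (forall s : seq X, (forall d, d \in s -> d != 0) ->
     exists2 u, B u & forall d, d \in s -> nu d u = 0) ->
  exists u : nat -> X, (forall n, B (u n)) /\ weakly_cvg u 0.
Proof.
move=> BS common.
have /choice[g gP] : forall s : seq X, exists u, B u /\
    forall d, d \in s -> d != 0 -> nu d u = 0.
  move=> s; have [d|u Bu uP] := common [seq d <- s | d != 0].
    by rewrite mem_filter => /andP[].
  by exists u; split => // d ds d0; apply: uP; rewrite mem_filter d0.
pose E := fix E n := if n is n'.+1 then
  E n' ++ g (E n') :: [seq midpoint x y | x <- E n', y <- E n'] else [::].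
pose u n := g (E n).
have Bu n : B (u n) by have [] := gP (E n).
have Emono m n d : (m <= n)%N -> d \in E m -> d \in E n.
  move=> /subnK <- dm; elim: (n - m)%N => [//|k IH].
  by rewrite addSn /= mem_cat IH.
have Ekill n m d : d \in E n -> d != 0 -> (n <= m)%N -> nu d (u m) = 0.
  by move=> dn d0 nm; have [_ H] := gP (E m); apply: H => //; exact: Emono nm dn.
exists u; split => // f cf.
(* The sign sg treats the two cases f (u i) >= eta and f (u i) <= - eta at once. *)
pose K (sg : bool) (eta : R) m := midpoint_hull
  [set x | exists2 i, (m <= i)%N & x = u i /\ eta <= (-1) ^+ sg * f (u i)].
have Kin sg eta m x : K sg eta m x -> exists n, x \in E n.
  elim=> [_ [i _ [-> _]]|y z _ [n yn] _ [n' zn']].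
    by exists i.+1; rewrite /= mem_cat mem_head orbT.
  exists (maxn n n').+1; rewrite /= mem_cat inE; apply/orP; right; apply/orP; right.
  by apply/allpairsP; exists (y, z); split => //=; [apply: Emono yn; exact: leq_maxl|apply: Emono zn'; exact: leq_maxr].
have no_bound (sg : bool) (eta : R) : 0 < eta ->
    (forall m, exists2 i, (m <= i)%N & eta <= (-1) ^+ sg * f (u i)) -> False.
  move=> eta0 inf_often.
  have f_ge m x : K sg eta m x -> eta <= (-1) ^+ sg * f x.
    elim=> [_ [i _ [-> //]]|y z _ fy _ fz].
    have -> : f (midpoint y z) = 2^-1 * (f y + f z) by rewrite linearZ linearD.
    lra.
  have [k k0 kP] : exists2 k : R, 0 < k & forall x, `|x| < k -> `|f x| < eta.
    have := cf 0; rewrite /continuous_at linear0 => /cvgrPdist_lt/(_ eta eta0) /nbhs_normP[k /= k0 kP].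
    exists k => // x xk; have := kP x; rewrite /= !sub0r !normrN; exact.
  have Kb m x : K sg eta m x -> k <= `|x| <= 1.
    move=> Kx; apply/andP; split.
      rewrite leNgt; apply/negP => /kP; apply/negP; rewrite -leNgt.
      apply: le_trans (f_ge m x Kx) _; apply: le_trans (ler_norm _) _.
      by rewrite normrM normr_sign mul1r.
    elim: Kx => [_ [i _ [-> _]]|y z _ y1 _ z1]; first by rewrite (BS _ (Bu i) : `|_| = 1).
    rewrite normrZ gtr0_norm ?invr_gt0 // ler_pdivrMl //.
    by have := ler_normD y z; lra.
  have [|||y [Ky /cvg_ex[l zl]]] := @uniformly_convex_nested (K sg eta) k k0 _ _ _ Kb.
  - move=> m n mn x; elim=> [_ [i ni [-> fi]]|v w _ Kv _ Kw].
      by apply: midpoint_hull_base; exists i => //; exact: leq_trans ni.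
    exact: midpoint_hull_mid.
  - by move=> m x z; exact: midpoint_hull_mid.
  - move=> m; have [i mi fi] := inf_often m; exists (u i).
    by apply: midpoint_hull_base; exists i.
  have y0 m : y m != 0.
    by rewrite -normr_gt0; have /andP[+ _] := Kb m _ (Ky m); exact: lt_le_trans.
  have kill m n : y m \in E n -> forall m' x, (n <= m')%N -> K sg eta m' x -> nu (y m) x = 0.
    move=> ymn m' x nm'; elim=> [_ [i mi [-> _]]|v w _ v0 _ w0].
      by apply: Ekill ymn _ _ => //; exact: leq_trans mi.
    by rewrite linearZ linearD v0 w0 addr0; exact: scaler0.
  have far m : 1 <= `|normalize (y m) - l|.
    have [n ymn] := Kin _ _ _ _ (Ky m).
    have [dn _] := norm_C1 (y0 m).
    have nul : nu (y m) l = 0.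
      have cn : nu (y m) (normalize (y m')) @[m' --> \oo] --> nu (y m) l.
        exact: cvg_comp zl (diff_continuous dn (x0 := l)).
      apply: (@closed_cvg _ _ (\oo : set_system nat) _ (fun m' => nu (y m) (normalize (y m'))) (fun r : R => r = 0)) cn.
        exact: closed_eq.
      exists n => // m' /= nm'; rewrite /normalize linearZ.
      by rewrite (kill m n ymn m' _ nm' (Ky m')); exact: scaler0.
    have := norm_diff_le norm_C1 (normalize (y m) - l) (y0 m).
    rewrite linearB nul subr0 /normalize linearZ.
    rewrite (norm_diff_self norm_C1 (y0 m)) [X in `|X|](_ : _ = 1) ?normr1 //.
    by apply: mulVf; rewrite normr_eq0.
  have /cvgrPdist_lt/(_ 1 ltr01)[N _ NP] := zl.
  have := NP N (leqnn N); apply/negP; rewrite -leNgt /= distrC; exact: far.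
rewrite linear0; apply/cvgrPdist_lt => eta eta0.
have ev (sg : bool) : exists m, forall i, (m <= i)%N -> (-1) ^+ sg * f (u i) < eta.
  apply: contrapT => /forallNP nex; apply: (no_bound sg eta eta0) => m.
  have /existsNP[i /not_implyP[mi /negP]] := nex m; rewrite -leNgt => fi.
  by exists i.
have [m1 H1] := ev false; have [m2 H2] := ev true.
exists (maxn m1 m2) => // i /= mi; rewrite sub0r normrN ltr_norml.
have := H1 i (leq_trans (leq_maxl _ _) mi); have := H2 i (leq_trans (leq_maxr _ _) mi).
by rewrite expr0 expr1 => *; apply/andP; split; lra.
Qed.

Section LevelsToInfinity.
Variable Phi : X -> R.
Hypothesis C1 : C1_off0 Phi.
Hypothesis h1 : H1 Phi.

(** If finitely many derivatives of the norm have no common zero on a sublevel set, they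
form an odd map that bounds the genus of its compact subsets. Otherwise the
sublevel set contains a weakly null sequence, against [H3]. *)
Lemma lambda_unbounded (M : R) : H3 Phi ->
  exists N, forall n, (N <= n)%N -> (M%:E <= lambda Phi n)%E.
Proof.
move=> h3; pose B := [set u | sphere X u /\ ray_value Phi u < M].
have [[s s0 sB]|nos] := pselect (exists2 s : seq X, (forall d, d \in s -> d != 0) &
    forall u, B u -> exists2 d, d \in s & nu d u != 0).
  exists (size s).+1 => n sn; apply: lambda_ge => [|F [cF sF SF /genus_geP nF]].
    exact: leq_trans sn.
  apply: contrapT => low.
  have FB a : F a -> B a.
    move=> Fa; split; first exact: SF.
    by rewrite ltNge; apply/negP => Ma; apply: low; exists a.
  have : (n <= size s)%N; last by rewrite leqNgt sn.
  apply: nF; exists (fun x => \row_(j < size s) nu (nth 0 s j) x); split.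
  - apply: rV_within_continuous => j; apply: continuous_subspaceT => x.
    under eq_fun do rewrite mxE.
    have [dn _] := norm_C1 (s0 _ (mem_nth 0 (ltn_ord j))).
    exact: (diff_continuous dn (x0 := x)).
  - by move=> u _; apply/rowP => j; rewrite !mxE linearN.
  - move=> a Fa; have [d ds da] := sB a (FB a Fa).
    apply: contra_neq da => /rowP row0.
    have ids : (index d s < size s)%N by rewrite index_mem.
    by have := row0 (Ordinal ids); rewrite !mxE /= nth_index.
exfalso; have [|u [uB wu]] := @weakly_null_sequence B (fun u uB => uB.1).
  move=> s s0; apply: contrapT => no; apply: nos; exists s => // u Bu.
  apply: contrapT => nod; apply: no; exists u => // d ds; apply/eqP.
  by apply: contrapT => /negP du; apply: nod; exists d.
have /cvgryPge/(_ M)[N _ NP] := h3 u (fun n => (uB n).1) wu.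
by have := NP N (leqnn N); rewrite /= leNgt; have [_ ->] := uB N.
Qed.

End LevelsToInfinity.

End WeaklyNullSequence.

(** * The ground state level and the number of critical points *)
Section GroundState.
Context {R : realType} {X : normedModType R} (Phi : X -> R).
Hypothesis C1 : C1_off0 Phi.
Hypothesis h1 : H1 Phi.

Local Notation t := (ray_time Phi).
Local Notation Psi := (ray_value Phi).

Lemma nehari_ray_value w : nehari Phi w -> Psi w = Phi w.
Proof. by move=> Nw; rewrite /ray_value (nehari_ray_time C1 h1 Nw) scale1r. Qed.

Lemma critical_nehari w : critical_points Phi w -> nehari Phi w.
Proof. by move=> [w0 dw]; split. Qed.

Lemma genus_family_pair u : sphere X u -> genus_family X 1 [set u; - u].
Proof.
move=> Su; split.
- by apply: finite_compact; exact: finite_set2.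
- apply/seteqP; split=> [_ [a [->|->] <-]|a [->|->]]; first by right.
  + by left; rewrite opprK.
  + by exists (- u); [right|rewrite opprK].
  + by exists u; [left|].
- by move=> a [->|->] //; rewrite /sphere /= normrN.
- apply/genus_geP => -[|k] // [f [_ _ nf]].
  have := nf u (or_introl erefl); apply: contraNT => _.
  by apply/eqP/rowP => -[].
Qed.

Lemma lambda1_sphere_inf : even_off0 Phi -> lambda Phi 1 = sphere_inf Phi.
Proof.
move=> ev; apply/eqP; rewrite eq_le; apply/andP; split.
  apply: le_ereal_inf_tmp => _ [u Su <-].
  apply: ge_ereal_inf; exists (ereal_sup [set (Psi v)%:E | v in [set u; - u]]).
    by exists [set u; - u] => //; exact: genus_family_pair.
  apply: ge_ereal_sup => _ [v [->|->] <-] //.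
  by rewrite (even_ray_value C1 h1 ev (sphere_neq0 Su)).
apply: le_ereal_inf_tmp => _ [F F1 <-].
have [a Fa] := genus_family_neq0 (ltn0Sn 0) F1; have [_ _ SF _] := F1.
apply: (@le_trans _ _ (Psi a)%:E).
  by apply: ereal_inf_lbound; exists a => //; exact: SF.
by apply: ereal_sup_ubound; exists a.
Qed.

Lemma sphere_inf_nehari_inf : sphere_inf Phi = nehari_inf Phi.
Proof.
rewrite /sphere_inf /nehari_inf; congr ereal_inf; apply/seteqP; split=> _ [u Su <-].
  by exists (t u *: u) => //; exact: (nehari_ray C1 h1 (sphere_neq0 Su)).
have [u0 _] := Su; exists (normalize u); first exact: normalize_sphere.
by rewrite (ray_value_normalize C1 h1 u0) nehari_ray_value.
Qed.

Lemma sphere_inf_ground_state u : sphere X u -> (Psi u)%:E = sphere_inf Phi ->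
  ground_state_level Phi (Psi u).
Proof.
move=> Su minu; split.
  exists (t u *: u) => //; apply: (minimizer_critical C1 h1 Su) => v Sv.
  by rewrite -lee_fin minu; apply: ereal_inf_lbound; exists v.
move=> _ [w /critical_nehari Nw <-].
rewrite -lee_fin minu sphere_inf_nehari_inf.
by apply: ereal_inf_lbound; exists w.
Qed.

Lemma finite_critical_points : even_off0 Phi ->
  finite_set (critical_pairs Phi) -> finite_set (critical_points Phi).
Proof.
move=> ev fin.
apply: (@sub_finite_set _ _ (\bigcup_(P in critical_pairs Phi) P)).
  move=> u [u0 du]; exists [set u; - u]; last by left.
  exists u; split => //; split; first by rewrite oppr_eq0.
  by move=> v; rewrite -[v]opprK (even_diff C1 ev).
apply: bigcup_finite => // P [u [_ _ ->]]; exact: finite_set2.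
Qed.

End GroundState.

(** With finitely many critical points two consecutive levels cannot coincide, so the
levels would be infinitely many distinct critical values. *)
Lemma infinite_critical_pairs (R : realType) (X : completeNormedModType R) (Phi : X -> R) :
  C1_off0 Phi -> H1 Phi -> infinite_dimensional X -> H2 Phi ->
  infinite_set (critical_pairs Phi).
Proof.
move=> C1 h1 Xinf h2; have [ev _ _] := h2.
move=> /(finite_critical_points C1 ev) fin.
have [s sE] := (finite_seqP _).1 fin.
have s0 x : x \in s -> x != 0.
  move=> xs; have : critical_points Phi x by rewrite sE.
  by case.
have lam_neq n : (0 < n)%N -> lambda Phi n != lambda Phi n.+1.
  move=> n0; apply/eqP => /(lambda_eq_critical C1 h1 Xinf h2 n0)/(_ s0)[w].
  by rewrite sE /= => ->.
pose l n := lambda Phi n.+1.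
have l_lt n : (l n < l n.+1)%E by rewrite lt_neqAle lam_neq // lambda_mono.
have l_incr m n : (m < n)%N -> (l m < l n)%E.
  elim: n => // n IH; rewrite ltnS leq_eqVlt => /orP[/eqP -> //|/IH mn].
  exact: lt_trans mn _.
have l_inj : {in l @^-1` (EFin @` (Phi @` critical_points Phi)) &, injective l}.
  move=> m n _ _ lmn; case: (ltngtP m n) => // /l_incr; by rewrite lmn ltxx.
have := finite_preimage l_inj (finite_image EFin (finite_image Phi fin)).
rewrite (_ : _ @^-1` _ = setT); first exact: infinite_nat.
apply/seteqP; split => // n _ /=; have [c lc [w cw wc]] := lambda_critical C1 h1 Xinf h2 (ltn0Sn n).
by exists c => //; exists w.
Qed.

Lemma lambda_cvg_pinfty (R : realType) (X : completeNormedModType R) (Phi : X -> R) :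
  uniformly_convex X -> C1_off0 (fun u : X => `|u|) -> C1_off0 Phi -> H1 Phi -> H3 Phi ->
  lambda Phi n @[n --> \oo] --> +oo%E.
Proof.
move=> uc nC1 C1 h1 h3; apply/cvgeyPge => M.
have [N NP] := lambda_unbounded uc nC1 M h3.
by exists N => // n; exact: NP.
Qed.

Lemma infinite_critical_values (R : realType) (X : completeNormedModType R) (Phi : X -> R) :
  C1_off0 Phi -> H1 Phi -> infinite_dimensional X -> H2 Phi ->
  lambda Phi n @[n --> \oo] --> +oo%E -> infinite_set (critical_values Phi).
Proof.
move=> C1 h1 Xinf h2 lamy /finite_seqP[s sE].
have [M MP] : exists M : R, forall c, c \in s -> c <= M.
  elim: (s) => [|c s' [M MP]]; first by exists 0.
  exists (Num.max c M) => x; rewrite inE => /orP[/eqP ->|/MP xM].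
    by rewrite le_max lexx.
  by rewrite le_max xM orbT.
have /cvgeyPge/(_ (M + 1))[N _ NP] := lamy.
have := NP N.+1 (leqnSn N); have [c -> cc] := lambda_critical C1 h1 Xinf h2 (ltn0Sn N).
have cs : c \in s by have : critical_values Phi c by []; rewrite sE.
by rewrite /= lee_fin => /le_trans/(_ (MP c cs)); rewrite gerDl ler10.
Qed.

Unset Implicit Arguments.
Theorem theorem2p1 (R : realType) (X : completeNormedModType R) (Phi : X -> R)
    (X_infdim : infinite_dimensional X)
    (X_uconvex : uniformly_convex X)
    (norm_C1 : C1_off0 (fun u : X => `|u|))
    (Phi_C1 : C1_off0 Phi)
    (Phi_H1 : H1 Phi) :
  [/\ (* (1) *)
      [/\ even_off0 Phi -> lambda Phi 1 = sphere_inf Phi,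
          sphere_inf Phi = nehari_inf Phi &
          (exists2 u, sphere X u & (ray_value Phi u)%:E = sphere_inf Phi) ->
          exists2 c : R, sphere_inf Phi = c%:E & ground_state_level Phi c],
      (* (2) *)
      H2 Phi ->
      [/\ forall m n : nat, (1 <= m)%N -> (m <= n)%N ->
            (lambda Phi m <= lambda Phi n)%E,
          forall n : nat, (1 <= n)%N ->
            exists2 c : R, lambda Phi n = c%:E & critical_values Phi c &
          infinite_set (critical_pairs Phi)] &
      (* (3) *)
      H2 Phi -> H3 Phi ->
      lambda Phi n @[n --> \oo] --> +oo%E /\
      infinite_set (critical_values Phi)].
Proof.
split.
- split; first exact: lambda1_sphere_inf.
    exact: sphere_inf_nehari_inf.
  move=> [u Su minu]; exists (ray_value Phi u) => //.
  exact: sphere_inf_ground_state.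
- move=> h2; split; first by move=> m n _ mn; exact: lambda_mono.
    by move=> n n0; exact: lambda_critical.
  exact: infinite_critical_pairs.
- move=> h2 h3; have lam_y := lambda_cvg_pinfty X_uconvex norm_C1 Phi_C1 Phi_H1 h3.
  by split => //; exact: infinite_critical_values.
Qed.
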